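(* Fix any strictly increasing sequence of finite intervals $(I_n)_{n\in\mathbb N}$ in $\mathbb Z$ and, for each $n\in\mathbb N$, let $\boldsymbol o_n$ be, conditionally on $V_{I_n}(\mathbf B)$, uniformly distributed on $V_{I_n}(\mathbf B)$ and independent of $\overline{\mathbf B}\cap I_n$ (including its marks). Then for all bounded measurable $g:\mathcal G_*\to\mathbb R_{\ge0}$ depending only on vertices at some bounded distance to the root, one has $$\frac{1}{\#V_{I_n}(\mathbf B)}\sum_{v\in V_{I_n}(\mathbf B)} g[\overline{\mathbf B}\cap I_n,v]\to\mathbb E^{\square}[g],\qquad \mathbb P\text{-a.s.}$$ as $n\to\infty$. In particular, $\mathbb P([\overline{\mathbf B}\cap I_n,\boldsymbol o_n]\in\cdot)\to\mathbb P^{\square}$ as $n\to\infty$ in the sense of local weak convergence.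
   Context: Doeblin graph. Let $(\Omega,\mathcal F,\mathbb P)$ be a probability space, $S$ a countable set, $\Xi$ a complete separable metric space, $h:S\times\Xi\to S$ a measurable map, and $\xi=(\xi_t)_{t\in\mathbb Z}$ a stationary and ergodic sequence of $\Xi$-valued random variables. The Doeblin graph $\mathbf G$ has vertex set $\mathbb Z\times S$ and a directed edge from each $(t,x)$ to $f_+(t,x):=(t+1,h(x,\xi_t))$. For $s\ge t$, $F^{(t,x)}_s\in S$ is defined by $(s,F^{(t,x)}_s)=f_+^{\,s-t}(t,x)$. A state $x$ is positive recurrent if $\mathbb E[\inf\{s>0:F^{(0,x)}_s=x\}]<\infty$. Bridge graph. Fix a positive recurrent state $x^*\in S$ (assumed to exist). The bridge graph $\mathbf B$ is the subgraph of $\mathbf G$ with vertex set $V(\mathbf B)=\bigcup_{t\in\mathbb Z}\{(s,F^{(t,x^* )}_s):s\ge t\}$ and, from each vertex $v$, the edge to $f_+(v)$. Put $V_t(\mathbf B)=\{(s,y)\in V(\mathbf B):s=t\}$ and $\mathbf B_t=\{y\in S:(t,y)\in V(\mathbf B)\}$. $\overline{\mathbf B}$ is $\mathbf B$ with spine added, i.e. together with edges from $(t,x^* )$ to $(t+1,x^* )$ for all $t\in\mathbb Z$. These graphs are viewed as networks: each vertex $(t,y)$ carries the mark $(y,\xi_t)$, and the direction of each edge is recorded by edge marks. For a finite interval $I\subseteq\mathbb Z$, $V_I(\mathbf B)=\bigcup_{t\in I}V_t(\mathbf B)$ and $\overline{\mathbf B}\cap I$ is the subgraph of $\overline{\mathbf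 B}$ induced by $V_I(\mathbf B)$; when it is not connected, $[\overline{\mathbf B}\cap I,v]$ means the rooted connected component of $v$. Networks. A network is a (nonempty, locally finite, connected) graph $\Gamma$ with marks, in a complete separable metric space, on vertices and on pairs (vertex, incident edge); all mark spaces are regarded as embedded in one fixed uncountable complete separable metric space. $[\Gamma,o]$ is the class of the network rooted at $o$ up to root- and mark-preserving isomorphism; $\mathcal G_*$ is the set of such classes, metrized by $d([\Gamma_1,o_1],[\Gamma_2,o_2])=1/(1+\alpha)$, where $\alpha$ is the supremum of $r>0$ such that there is a rooted isomorphism of the balls of graph radius $\lfloor r\rfloor$ around the roots for which corresponding marks are at distance less than $1/r$. Local weak convergence is weak convergence of probability measures on $\mathcal G_*$. The function $g$ depends only on vertices at bounded distance to the root if for some $N$, $g[\Gamma,o]$ is determined by the (marked, rooted) ball of radius $N$ around $o$. The measure $\mathbb P^{\square}$ on $\mathcal G_*$ is $\mathbb P^{\square}(A)=\frac{1}{\mathbb E[\#\mathbf B_0]}\mathbb E\big[\sum_{w\in V_0(\mathbf B)}1_{\{[\overline{\mathbf B},w]\in A\}}\big]$, and $\mathbb E^{\square}$ is expectation under it. *)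

(* Defs.v *)
From HB Require Import structures.
From mathcomp Require Import all_boot all_order all_algebra finmap.
From mathcomp Require Import all_classical all_reals all_analysis.

Set Implicit Arguments.
Unset Strict Implicit.
Unset Printing Implicit Defensive.
Import Order.TTheory GRing.Theory Num.Theory.
Import numFieldNormedType.Exports.
Local Open Scope classical_set_scope.
Local Open Scope ring_scope.

#[short(type="completeMetricType")]
HB.structure Definition CompleteMetric (R : realType) :=
  {T of Metric R T & Complete T}.

Definition separable (T : topologicalType) :=
  exists2 D : set T, countable D & dense D.

Notation borelType T := (g_sigma_algebraType (@open T)).

Notation discreteType T := (g_sigma_algebraType [set: set T]).

(* A simple graph on a subset of [V]; [emark u v] is the mark of the pair
   (vertex [u], edge {u, v}). Marks are irrelevant off [vert] and [adj]. *)
Record mgraph (M V : Type) := MGraph {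
  vert : set V ;
  adj : V -> V -> Prop ;
  vmark : V -> M ;
  emark : V -> V -> M ;
  adj_vert : forall u v, adj u v -> vert u ;
  adj_sym : forall u v, adj u v -> adj v u ;
  adj_irr : forall u, ~ adj u u
}.

Section mgraph.
Context (M V : Type).
Implicit Types (G : mgraph M V).

Section induced.
Variables (G : mgraph M V) (A : set V).

Let iadj u v := [/\ adj G u v, A u & A v].

Let iadj_vert u v : iadj u v -> (vert G `&` A) u.
Proof. by move=> [/(@adj_vert _ _ G)]. Qed.

Let iadj_sym u v : iadj u v -> iadj v u.
Proof. by move=> [/(@adj_sym _ _ G)]. Qed.

Let iadj_irr u : ~ iadj u u.
Proof. by move=> [/(@adj_irr _ _ G)]. Qed.

Definition induced :=
  @MGraph M V (vert G `&` A) iadj (vmark G) (emark G)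
    iadj_vert iadj_sym iadj_irr.
End induced.

(* The vertices at graph distance at most [n] from [o]. *)
Fixpoint reach G (o : V) (n : nat) : set V :=
  if n is m.+1 then
    reach G o m `|` [set v | exists2 u, reach G o m u & adj G u v]
  else [set o] `&` vert G.

Definition ball_graph G o n := induced G (reach G o n).

Definition component G o := induced G (\bigcup_n reach G o n).

Definition locally_finite G :=
  forall u, vert G u -> finite_set [set v | adj G u v].

Definition connected_graph G :=
  forall u v, vert G u -> vert G v -> exists n, reach G u n v.

Definition is_network G :=
  [/\ vert G !=set0, locally_finite G & connected_graph G].

End mgraph.

(* Isomorphism of rooted graphs for which corresponding marks are related by
   [sim]. *)
Definition rooted_iso (M V W : Type) (sim : M -> M -> Prop)
    (G : mgraph M V) (o : V) (H : mgraph M W) (p : W) :=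
  exists f : V -> W, [/\ set_bij (vert G) (vert H) f, f o = p,
    forall u v, vert G u -> vert G v -> (adj G u v <-> adj H (f u) (f v)),
    forall u, vert G u -> sim (vmark G u) (vmark H (f u)) &
    forall u v, adj G u v -> sim (emark G u v) (emark H (f u) (f v))].

(* Networks are countable, so the vertex sets may be taken inside [nat]: an
   isomorphism class is represented by the set of its members living on
   [nat]. *)
Definition rooted_graph (M : Type) := (mgraph M nat * nat)%type.

Definition is_rooted_network M (N : rooted_graph M) :=
  is_network N.1 /\ vert N.1 N.2.

Definition iso_members (M V : Type) (G : mgraph M V) (o : V) :
    set (rooted_graph M) :=
  [set N | is_rooted_network N /\ rooted_iso eq G o N.1 N.2].

Record Gstar (R : realType) (M : completeMetricType R) := MkGstar {
  members :> set (rooted_graph M) ;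
  membersP : exists2 N, is_rooted_network N & members = iso_members N.1 N.2
}.

Section singleton_network.
Context (M : pointedType).

Let sadj (u v : nat) := False.

Definition singleton_graph : mgraph M nat :=
  @MGraph M nat [set 0%N] sadj (fun=> point) (fun _ _ => point)
    (fun u v (h : sadj u v) => False_ind _ h) (fun u v h => h) (fun u h => h).

Lemma singleton_graphP : is_rooted_network (singleton_graph, 0%N).
Proof.
split=> //; split; first by exists 0%N.
- by move=> u _; apply: (sub_finite_set (B := set0)).
- by move=> u v -> ->; exists 0%N.
Qed.
End singleton_network.

Section Gstar.
Context (R : realType) (M : completeMetricType R).
Local Notation Gstar := (Gstar M).

HB.instance Definition _ := gen_eqMixin Gstar.
HB.instance Definition _ := gen_choiceMixin Gstar.
HB.instance Definition _ := isPointed.Build Gstar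
  (MkGstar (ex_intro2 _ _ _ (singleton_graphP M) erefl)).

(* [Gamma, o]: the class of the component of [o]. Total, with the junk value
   [point] when that component is not a network, i.e. when it is not locally
   finite or [o] is not a vertex. *)
Definition net_class (V : Type) (G : mgraph M V) (o : V) : Gstar :=
  xget point [set C : Gstar | members C = iso_members (component G o) o].

Definition balls_similar (sim : M -> M -> Prop) (n : nat) (C D : Gstar) :=
  exists N N', [/\ members C N, members D N' &
    rooted_iso sim (ball_graph N.1 N.2 n) N.2 (ball_graph N'.1 N'.2 n) N'.2].

Definition gdist_sup (C D : Gstar) : \bar R :=
  ereal_sup [set r%:E | r in [set r : R | 0 < r /\
    balls_similar (fun a b => @mdist R M a b < r^-1) (Num.truncn r) C D]].

Definition gdist (C D : Gstar) : R := fine ((1 + gdist_sup C D)^-1)%E.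

Let gopen (A : set Gstar) :=
  forall C, A C -> exists2 e, 0 < e & forall D, gdist C D < e -> A D.

Let gopenT : gopen setT.
Proof. by move=> C _; exists 1. Qed.

Let gopenI : setI_closed gopen.
Proof.
move=> A B oA oB C [/oA[e e0 eA] /oB[f f0 fB]].
exists (Num.min e f); first by rewrite lt_min e0.
by move=> D; rewrite lt_min => /andP[/eA ? /fB].
Qed.

Let gopen_bigU (I : Type) (f : I -> set Gstar) :
  (forall i, gopen (f i)) -> gopen (\bigcup_i f i).
Proof.
move=> of_ C [i _ /of_[e e0 eC]]; exists e => // D /eC fD; by exists i.
Qed.

HB.instance Definition _ :=
  isOpenTopological.Build Gstar gopenT gopenI gopen_bigU.

HB.instance Definition _ := @isMeasurable.Build (sigma_display (@open Gstar))
  Gstar <<s @open Gstar >> (@sigma_algebra0 _ setT _) (@sigma_algebraC _ _)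
  (@sigma_algebra_bigcup _ setT _).

Definition local_functional (g : Gstar -> R) :=
  exists N, forall C D, balls_similar eq N C D -> g C = g D.

(* Weak convergence, for the set functions [mu_ n] and [mu] (in practice,
   Borel probability measures). *)
Definition weak_cvg (mu_ : nat -> set Gstar -> \bar R)
    (mu : set Gstar -> \bar R) :=
  forall f : Gstar -> R, continuous f -> (exists B, forall C, `|f C| <= B) ->
    (\int[mu_ n]_C (f C)%:E)%E @[n --> \oo] --> (\int[mu]_C (f C)%:E)%E.

End Gstar.

Section stationary_ergodic.
Context d (Omega : measurableType d) (R : realType) (P : probability Omega R).
Context (Xi : ptopologicalType) (xi : int -> Omega -> Xi).

Definition product_events : set (set (int -> Xi)) :=
  <<s [set A | exists (t : int) (C : set (borelType Xi)),
         measurable C /\ A = [set x | C (x t)]] >>.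

Definition shift (x : int -> Xi) : int -> Xi := fun t => x (t + 1).

Definition trajectory (w : Omega) : int -> Xi := fun t => xi t w.

Definition stationary := forall A, product_events A ->
  P [set w | A (shift (trajectory w))] = P [set w | A (trajectory w)].

Definition ergodic := forall A, product_events A -> shift @^-1` A = A ->
  P [set w | A (trajectory w)] = 0%E \/ P [set w | A (trajectory w)] = 1%E.

End stationary_ergodic.

Section doeblin.
Context d (Omega : measurableType d) (R : realType) (P : probability Omega R).
Context (S : pointedType) (Xi : completeMetricType R).
Context (h : S * Xi -> S) (xi : int -> Omega -> Xi).

(* The Doeblin graph has exactly one edge out of each vertex [v], to
   [f_plus w v]. *)
Definition f_plus (w : Omega) (v : int * S) : int * S :=
  (v.1 + 1, h (v.2, xi v.1 w)).

(* F^{(t,x)}_s, meaningful for t <= s. *)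
Definition doeblin_state (w : Omega) (t : int) (x : S) (s : int) : S :=
  (iter `|s - t|%N (f_plus w) (t, x)).2.

(* Equal to +oo when there is no return. *)
Definition return_time (x : S) (w : Omega) : \bar R :=
  ereal_inf [set (s%:R)%:E | s in
    [set s : nat | (0 < s)%N /\ doeblin_state w 0 x s%:Z = x]].

Definition positive_recurrent (x : S) :=
  (\int[P]_w return_time x w < +oo)%E.

Context (xs : S).

Definition bridge_vert (w : Omega) : set (int * S) :=
  \bigcup_(t in [set: int])
    [set (s, doeblin_state w t xs s) | s in [set s | t <= s]].

(* B_t *)
Definition bridge_states (w : Omega) (t : int) : set S :=
  [set y | bridge_vert w (t, y)].

(* V_I(B) *)
Definition bridge_window (I : set int) (w : Omega) : set (int * S) :=
  [set v | bridge_vert w v /\ I v.1].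

Definition bridge_edge (w : Omega) (u v : int * S) :=
  bridge_vert w u /\ v = f_plus w u.

Definition spine_edge (u v : int * S) :=
  u.2 = xs /\ v = (u.1 + 1, xs).

Definition spined_edge (w : Omega) (u v : int * S) :=
  bridge_edge w u v \/ spine_edge u v.

Lemma spined_edge_time w u v : spined_edge w u v -> v.1 = u.1 + 1.
Proof. by case=> -[_ ->]. Qed.

Lemma spined_edge_vert w u v :
  spined_edge w u v -> bridge_vert w u /\ bridge_vert w v.
Proof.
have spineP t : bridge_vert w (t, xs).
  by exists t => //; exists t => //=; rewrite /doeblin_state subrr.
case=> [[uB ->]|[]]; last by case: u => t x /= -> ->.
split=> //; case: uB => t _ [s /= ts <-]; exists t => //.
exists (s + 1); first by rewrite /= (le_trans ts)// lerDl.
move: ts; rewrite -subr_ge0 /f_plus /doeblin_state /=.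
case E : (s - t) => [n|//] _.
have -> : s + 1 - t = n.+1%:Z by rewrite addrAC E -addn1.
have -> : s = t + n%:Z by rewrite -E addrC subrK.
have iter1 : (iter n (f_plus w) (t, xs)).1 = t + n%:Z.
  by elim: n {E} => [|n /= ->]; rewrite ?addr0// -addrA -PoszD addn1.
by rewrite /= /f_plus /= iter1.
Qed.

Section network.
Context (M : completeMetricType R) (iota : S * Xi -> M) (kappa : bool -> M).

Section bar.
Variable w : Omega.

Let badj u v := spined_edge w u v \/ spined_edge w v u.

Let badj_vert u v : badj u v -> bridge_vert w u.
Proof. by case=> /spined_edge_vert[]. Qed.

Let badj_sym u v : badj u v -> badj v u.
Proof. by case; [right|left]. Qed.

Let badj_irr u : ~ badj u u.
Proof.
by case=> /spined_edge_time /eqP; rewrite -subr_eq0 opprD addNKr oppr_eq0.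
Qed.

(* The bridge graph with spine added. [iota] and [kappa] embed the spaces of
   vertex marks and of edge directions into the common mark space: the pair
   (u, edge) is marked [kappa true] when [u] is the origin of the edge and
   [kappa false] when it is its end. *)
Definition bar_bridge : mgraph M (int * S) :=
  @MGraph M _ (bridge_vert w) badj (fun v => iota (v.2, xi v.1 w))
    (fun u v => kappa `[< spined_edge w u v >])
    badj_vert badj_sym badj_irr.
End bar.

Definition bar_bridge_window (I : set int) (w : Omega) : mgraph M (int * S) :=
  induced (bar_bridge w) (bridge_window I w).

Definition square_measure (A : set (Gstar M)) : \bar R :=
  ((\int[P]_w counting (bridge_states w 0))^-1 *
   \int[P]_w \esum_(v in bridge_window [set 0%R] w)
     (\1_A (net_class (bar_bridge w) v))%:E)%E.

End network.
End doeblin.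

Section conditional_root.
Context d (Omega : measurableType d) (R : realType) (P : probability Omega R).
Context (V : choiceType) (M : completeMetricType R).

Definition graph_events (G : Omega -> mgraph M V) : set (set Omega) :=
  <<s [set E | exists u v : V, exists2 C : set (borelType M), measurable C &
         [\/ E = [set w | vert (G w) u],
             E = [set w | adj (G w) u v],
             E = [set w | vert (G w) u /\ C (vmark (G w) u)] |
             E = [set w | adj (G w) u v /\ C (emark (G w) u v)]]] >>.

(* The random vertex set [W] is almost surely finite, so that conditioning on
   it is conditioning on the events [W = A] for A finite. *)
Definition conditionally_uniform (W : Omega -> set V) (o : Omega -> V) :=
  forall (A : {fset V}) (v : V),
    P ([set w | o w = v] `&` [set w | W w = [set` A]]) =
    (P [set w | W w = [set` A]] *
     (if v \in A then ((#|` A|%:R : R)^-1)%:E else 0))%E.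

Definition conditionally_independent (W : Omega -> set V) (o : Omega -> V)
    (G : Omega -> mgraph M V) :=
  forall (A : {fset V}) (v : V) (E : set Omega), graph_events G E ->
    (P ([set w | o w = v] `&` E `&` [set w | W w = [set` A]]) *
     P [set w | W w = [set` A]] =
     P ([set w | o w = v] `&` [set w | W w = [set` A]]) *
     P (E `&` [set w | W w = [set` A]]))%E.

End conditional_root.

(* Main.v *)
(* The bridge graph is a function of the driving sequence, so everything takes
   place on the space of paths, where the shift is ergodic.  A state of B_0 is
   reached from x*, at its last visit before time 0 on a path leading to the
   state, by a path avoiding x*; hence #B_0 <= sum_k 1{tau o theta^(-k) > k}
   with tau the return time of x*, and E[#B_0] <= E[tau] is finite.

   Birkhoff's theorem is obtained from the maximal ergodic argument: if f has
   negative mean, then its Birkhoff sums are almost surely bounded above.  The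
   windows I_n need not have a fixed endpoint, but they eventually contain a
   common base point, and each window sum splits there into a forward and a
   backward Birkhoff sum.

   Replacing the bridge by its restriction to I_n changes the value of g only at
   vertices near the boundary of I_n, whose share is negligible, and at vertices
   where g is sensitive to a far-away cut, whose density vanishes with the
   distance of the cut: for g local or continuous, every vertex stops being
   sensitive when the cut is far enough.  Both parts of the theorem thus follow
   from the same averages, the second one by taking expectations. *)

Require Import Defs.
From HB Require Import structures.
From mathcomp Require Import all_boot all_order all_algebra finmap.
From mathcomp Require Import all_classical all_reals all_analysis.
From mathcomp Require Import measurable_realfun zify ring lra.

Set Implicit Arguments.
Unset Strict Implicit.
Unset Printing Implicit Defensive.
Import Order.TTheory GRing.Theory Num.Theory.
Import numFieldNormedType.Exports.
Local Open Scope classical_set_scope.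
Local Open Scope ring_scope.

(** * Graphs up to rooted isomorphism *)

(** [Omega] itself carries no shift: stationarity and ergodicity speak only of the law of the
    trajectory. The network is therefore rebuilt over the canonical process, and almost sure
    statements are pulled back to [Omega]. The obstacle specific to networks is measurability. The
    class [Gamma, o] takes values in isomorphism classes, with open sets given by a distance defined
    through isomorphisms, and has a default value when balls are infinite. Its preimages are handled
    by pinning down finite balls with countably many events. Doing this inside [graph_events], and
    not just inside [measurable], is what allows the conditional independence of the root to be
    applied to the class. Sensitivity is tested against all cuts at distance at least p on both
    sides at once. It thus becomes a single observable moving with the shift, whose sum over a time
    slice is dominated by #B_0. P^square is given as a set function; it is matched on measurable
    sets with a measure built as a series of pushforwards, and the law of the window seen from its
    uniform root is treated in the same way. *)

Section graph.
Context (M : Type).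

Lemma mgraph_eq V (G H : mgraph M V) :
  vert G = vert H -> (forall u v, adj G u v <-> adj H u v) ->
  vmark G = vmark H -> emark G = emark H -> G = H.
Proof.
case: G => vG aG mG eG a1 a2 a3; case: H => vH aH mH eH b1 b2 b3 /= ev ea em ee.
have {}ea : aG = aH by apply/funext => u; apply/funext => v; apply/propext.
subst; congr MGraph; exact: Prop_irrelevance.
Qed.

Lemma reach_vert V (G : mgraph M V) o n u : reach G o n u -> vert G u.
Proof.
elim: n u => [|n IH] u /=; first by case.
by case=> [/IH//|[v _ uv]]; exact: adj_vert (adj_sym uv).
Qed.

Lemma reach_root V (G : mgraph M V) o n u : reach G o n u -> vert G o.
Proof.
elim: n u => [|n IH] u /=; first by case=> ->.
by case=> [/IH//|[v /IH]].
Qed.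

Lemma reach_le V (G : mgraph M V) o m n :
  (m <= n)%N -> reach G o m `<=` reach G o n.
Proof.
move=> /subnKC <-; elim: (n - m)%N => [|k IH]; first by rewrite addn0.
by rewrite addnS /= => u /IH; left.
Qed.

Lemma reach_trans V (G : mgraph M V) u v w m n :
  reach G u m v -> reach G v n w -> reach G u (m + n) w.
Proof.
move=> uv; elim: n w => [|n IH] w /=; first by rewrite addn0 => -[-> _].
rewrite addnS => -[/IH|[x /IH ux xw]]; first by left.
by right; exists x.
Qed.

Lemma reach_sym V (G : mgraph M V) u v n : reach G u n v -> reach G v n u.
Proof.
elim: n v => [|n IH] v /=; first by case=> ->.
case=> [/IH|[x /IH xu xv]]; first by left.
have vx : reach G v 1 x.
  right; exists v; last exact: adj_sym.
  by split=> //; apply: adj_vert (adj_sym xv).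
exact: (reach_trans vx xu).
Qed.

Lemma reach_locally_finite V (G : mgraph M V) o n :
  locally_finite G -> finite_set (reach G o n).
Proof.
move=> lf; elim: n => [|n IH]; first exact: finite_setIl.
rewrite /= finite_setU; split=> //.
have -> : [set v | exists2 u, reach G o n u & adj G u v] =
    \bigcup_(u in reach G o n) [set v | adj G u v].
  by apply/seteqP; split => v [u]; exists u.
by apply: bigcup_finite => // u ou; exact/lf/(reach_vert ou).
Qed.

Lemma reach_component V (G : mgraph M V) o n :
  reach (component G o) o n = reach G o n.
Proof.
elim: n => [|n IH] /=.
  apply/seteqP; split=> u /= [-> //] => [[]//|ov].
  by split=> //; split=> //; exists 0%N.
rewrite IH; congr (_ `|` _); apply/seteqP; split => v [u uo /=].
  by case=> uv _ _; exists u.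
move=> uv; exists u => //; split=> //; first by exists n.
by exists n.+1 => //; right; exists u.
Qed.

(** Classes are taken of the component of the root, but distances involve balls only, so they can be
    computed in the original graph. *)
Lemma ball_component V (G : mgraph M V) o n :
  ball_graph (component G o) o n = ball_graph G o n.
Proof.
rewrite /ball_graph; apply: mgraph_eq => //=; rewrite reach_component.
  by apply/seteqP; split => u /= [] => [[]//|? ?]; do !split => //; exists n.
move=> u v /=; split => -[] => [[]//|? ? ?]; do !split => //; by exists n.
Qed.

Lemma component_vert V (G : mgraph M V) o : vert G o -> vert (component G o) o.
Proof. by move=> oG; split=> //; exists 0%N. Qed.

(** The neighbours of a vertex at distance n lie in the ball of radius n + 1, so finite balls around
    the root force local finiteness of the whole component. *)
Lemma component_network V (G : mgraph M V) o :
  vert G o -> (forall n, finite_set (reach G o n)) ->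
  is_network (component G o).
Proof.
move=> oG fin; split.
- by exists o; apply: component_vert.
- move=> u /= [_ [n _ un]]; apply: sub_finite_set (fin n.+1) => v /= [uv _ _].
  by right; exists u.
- move=> u v [_ [m _]] + [_ [n _]]; rewrite -!(@reach_component _ G).
  move=> ou ov; exists (m + n)%N; exact: reach_trans (reach_sym ou) ov.
Qed.

Section iso.
Context (V W : Type) (sim : M -> M -> Prop).
Implicit Types (G : mgraph M V) (H : mgraph M W).

Lemma rooted_iso_sym (sim' : M -> M -> Prop) G o H p :
  (forall a b, sim a b -> sim' b a) -> vert G o ->
  rooted_iso sim G o H p -> rooted_iso sim' H p G o.
Proof.
move=> ss oG [f [[fG finj fsurj] fo fadj fv fe]].
have /choice[g gP] : forall w, exists u, vert H w -> vert G u /\ f u = w.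
  move=> w; have [wH|wH] := pselect (vert H w); last by exists o.
  by have [u uG uw] := fsurj _ wH; exists u.
have gf u : vert G u -> g (f u) = u.
  move=> uG; have [] := gP (f u) (fG _ uG) => guG gfu.
  by apply: finj; rewrite ?inE.
exists g; split.
- split.
  + by move=> w /= /gP[].
  + move=> w w'; rewrite !inE => /gP[_ e] /gP[_ e'] ww.
    by rewrite -e -e' ww.
  + by move=> u uG; exists (f u); [exact: fG | exact: gf].
- by rewrite -fo gf.
- move=> w w' wH w'H; have [? e] := gP _ wH; have [? e'] := gP _ w'H.
  by rewrite -[in adj H _ _]e -[in adj H _ _]e'; apply: iff_sym; apply: fadj.
- move=> w wH; have [? e] := gP _ wH; rewrite -[X in vmark H X]e.
  by apply: ss; apply: fv.
- move=> w w' ww'; have wH := adj_vert ww'; have w'H := adj_vert (adj_sym ww').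
  have [wG e] := gP _ wH; have [w'G e'] := gP _ w'H.
  rewrite -[X in emark H X]e -[X in emark H _ X]e'; apply: ss; apply: fe.
  by apply/(fadj _ _ wG w'G); rewrite e e'.
Qed.

Lemma rooted_iso_trans (U : Type) (sim2 sim3 : M -> M -> Prop)
    G o H p (K : mgraph M U) q :
  (forall a b c, sim a b -> sim2 b c -> sim3 a c) ->
  rooted_iso sim G o H p -> rooted_iso sim2 H p K q -> rooted_iso sim3 G o K q.
Proof.
move=> s3 [f [bf fo fadj fv fe]] [g [bg go gadj gv ge]].
have fG u : vert G u -> vert H (f u) by case: bf => + _ _; apply.
exists (g \o f); split; rewrite /= ?fo//.
- exact: set_bij_comp bf bg.
- by move=> u v uG vG; rewrite fadj// gadj//; apply: fG.
- by move=> u uG; apply: s3 (fv _ uG) (gv _ (fG _ uG)).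
- move=> u v uv; apply: s3 (fe _ _ uv) (ge _ _ _).
  apply/fadj => //; first exact: adj_vert uv.
  exact: adj_vert (adj_sym uv).
Qed.

Lemma rooted_iso_reach G o H p (f : V -> W) n u :
  set_bij (vert G) (vert H) f -> f o = p ->
  (forall u v, vert G u -> vert G v -> (adj G u v <-> adj H (f u) (f v))) ->
  vert G o -> vert G u -> (reach G o n u <-> reach H p n (f u)).
Proof.
move=> [fG finj fsurj] <- fadj oG; elim: n u => [|n IH] u uG /=.
  split => [[-> ?]|[e ?]]; split=> //; first exact: fG.
  by apply: finj; rewrite ?inE.
split => -[/(IH _ uG)|]; try by left.
- move=> [v ov vu]; right; have vG := reach_vert ov.
  by exists (f v); [apply/IH | apply/fadj].
- move=> [w ow wu]; right; have [v vG e] := fsurj _ (reach_vert ow).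
  by exists v; [apply/IH => //; rewrite e | apply/fadj => //; rewrite e].
Qed.

Lemma rooted_iso_induced G o H p (A : set V) (B : set W) (f : V -> W) :
  set_bij (vert G) (vert H) f -> f o = p ->
  (forall u v, vert G u -> vert G v -> (adj G u v <-> adj H (f u) (f v))) ->
  (forall u, vert G u -> A u -> sim (vmark G u) (vmark H (f u))) ->
  (forall u v, adj G u v -> A u -> A v ->
     sim (emark G u v) (emark H (f u) (f v))) ->
  (forall u, vert G u -> (A u <-> B (f u))) ->
  rooted_iso sim (Defs.induced G A) o (Defs.induced H B) p.
Proof.
move=> [fG finj fsurj] fo fadj fv fe AB; exists f; split => //=.
- split.
  + by move=> u [uG uA]; split; [exact: fG|apply/AB].
  + by move=> u v; rewrite !inE => -[? _] [? _]; apply: finj; rewrite inE.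
  + move=> w [wH wB]; have [u uG e] := fsurj _ wH.
    by exists u => //; split=> //; apply/AB; rewrite ?e.
- move=> u v [uG uA] [vG vA]; split => -[+ _ _] => /fadj uv;
    by split; [exact: uv|..]; rewrite -?AB.
- by move=> u [uG uA]; apply: fv.
- by move=> u v [uv uA vA]; apply: fe.
Qed.

Lemma rooted_iso_ball G o H p n :
  vert G o -> rooted_iso sim G o H p ->
  rooted_iso sim (ball_graph G o n) o (ball_graph H p n) p.
Proof.
move=> oG [f [bf fo fadj fv fe]];
  apply: (@rooted_iso_induced _ _ _ _ _ _ f) => //.
- by move=> u uG _; exact: fv.
- by move=> u v uv _ _; exact: fe.
- by move=> u uG; exact: (rooted_iso_reach _ bf fo fadj oG uG).
Qed.

Lemma rooted_iso_component G o H p :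
  vert G o -> rooted_iso sim G o H p ->
  rooted_iso sim (component G o) o (component H p) p.
Proof.
move=> oG [f [bf fo fadj fv fe]];
  apply: (@rooted_iso_induced _ _ _ _ _ _ f) => //.
- by move=> u uG _; exact: fv.
- by move=> u v uv _ _; exact: fe.
- move=> u uG; split => -[n _ un]; exists n => //.
    exact/(rooted_iso_reach _ bf fo fadj oG uG).
  exact/(rooted_iso_reach n bf fo fadj oG uG).
Qed.

Lemma rooted_iso_network G o H p :
  rooted_iso sim G o H p -> is_network G -> is_network H.
Proof.
move=> [f [bf fo fadj fv fe]] [[x xG] lf conn].
have [fG finj fsurj] := bf; split.
- by exists (f x); exact: fG.
- move=> w /fsurj[u uG <-].
  apply: sub_finite_set (finite_image f (lf _ uG)) => w' /= uw'.
  have [v vG e] := fsurj _ (adj_vert (adj_sym uw')).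
  by exists v => //; apply/fadj => //; rewrite e.
- move=> w w' /fsurj[u uG <-] /fsurj[v vG <-].
  have [n un] := conn _ _ uG vG; exists n.
  exact/(rooted_iso_reach n bf erefl fadj uG vG).
Qed.

End iso.

(** Supplies the representative on [nat] that a class requires: vertices are relabelled by an
    injection, and marks are read back through its left inverse [dec]. *)
Lemma rooted_iso_nat V (G : mgraph M V) o : countable [set: V] ->
  exists (H : mgraph M nat) p, vert G o -> vert H p /\ rooted_iso eq G o H p.
Proof.
move=> cV; have /pcard_injP[pk] := cV; rewrite /= => pkI.
have pk_inj : injective pk by move=> u v; apply: pkI; rewrite inE.
have /choice[dec decP] : forall a, exists u, (exists v, pk v = a) -> pk u = a.
  move=> a; have [[v va]|h] := pselect (exists v, pk v = a); first by exists v.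
  by exists o => -[v va]; case: h; exists v.
have decK u : dec (pk u) = u by apply: pk_inj; apply: decP; exists u.
pose hadj a b := exists u v, [/\ pk u = a, pk v = b & adj G u v].
have h1 a b : hadj a b -> (pk @` vert G) a.
  by move=> [u [v [<- _ uv]]]; exists u => //; exact: adj_vert uv.
have h2 a b : hadj a b -> hadj b a.
  by move=> [u [v [ua vb uv]]]; exists v, u; split => //; exact: adj_sym.
have h3 a : ~ hadj a a.
  by move=> [u [v [<- /pk_inj -> uu]]]; exact: adj_irr uu.
exists (MGraph (vmark G \o dec) (fun a b => emark G (dec a) (dec b)) h1 h2 h3).
exists (pk o) => oG; split; first by exists o.
exists pk; split => //=.
- split; first by move=> u uG; exists u.
    by move=> u v _ _ /pk_inj.
  by move=> a [u uG <-]; exists u.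
- move=> u v uG vG; split=> [uv|]; first by exists u, v.
  by move=> [u' [v' [/pk_inj -> /pk_inj ->]]].
- by move=> u _; rewrite decK.
- by move=> u v _; rewrite !decK.
Qed.

End graph.

Section net_class.
Context (R : realType) (M : completeMetricType R).
Implicit Types (sim : M -> M -> Prop).

Lemma members_net_class V (G : mgraph M V) o : countable [set: V] ->
  vert G o -> (forall n, finite_set (reach G o n)) ->
  members (net_class G o) = iso_members (component G o) o.
Proof.
move=> cV oG fin; rewrite /net_class.
have [H [p /(_ (component_vert oG)) [pH iso]]] :=
  rooted_iso_nat (component G o) o cV.
have net := rooted_iso_network iso (component_network oG fin).
have e : iso_members (component G o) o = iso_members H p.
  apply/seteqP; split => N [[nN pN] isoN]; split => //.
    apply: rooted_iso_trans isoN; first by move=> a b c -> ->.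
    by apply: rooted_iso_sym iso => //; exact: component_vert.
  by apply: rooted_iso_trans iso isoN => a b c -> ->.
have hC : exists2 N : rooted_graph M, is_rooted_network N &
    iso_members (component G o) o = iso_members N.1 N.2 by exists (H, p).
exact: (xgetPex point (ex_intro
  [set C : Gstar M | members C = iso_members (component G o) o]
  (MkGstar hC) erefl)).
Qed.

(** A class with the right members would contain a network isomorphic to the component, which forces
    [o] to be a vertex and its balls to be finite. Together with [members_net_class] this describes
    [net_class] on every outcome, as its measurability demands. *)
Lemma net_class_point V (G : mgraph M V) o :
  ~ (vert G o /\ forall n, finite_set (reach G o n)) ->
  net_class G o = point.
Proof.
move=> h; apply: xgetPN => C /= eC; apply: h.
case: (membersP C) => N netN; rewrite eC => eN.
have : iso_members N.1 N.2 N.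
  split => //; exists id; split => //; split => //.
  by move=> u uN; exists u.
rewrite -eN => -[_] iso; have [f [[_ _ fs] fo _ _ _]] := iso.
have oG : vert G o.
  case: (netN) => _ /fs[u [uG [n _ ou]]] _; exact: reach_root ou.
split=> // n; rewrite -reach_component; apply: reach_locally_finite.
have iso' := rooted_iso_sym (fun a b (e : a = b) => esym e) (component_vert oG)
  iso.
by case: netN => netN _; have [] := rooted_iso_network iso' netN.
Qed.

Lemma net_class_iso V W (G : mgraph M V) o (H : mgraph M W) p :
  vert G o -> rooted_iso eq (component G o) o (component H p) p ->
  net_class G o = net_class H p.
Proof.
move=> oG iso; rewrite /net_class.
suff -> : iso_members (component G o) o = iso_members (component H p) p by [].
apply/seteqP; split => N [netN isoN]; split => //.
  apply: rooted_iso_trans isoN; first by move=> a b c -> ->.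
  by apply: rooted_iso_sym iso => //; exact: component_vert.
by apply: rooted_iso_trans iso isoN => a b c -> ->.
Qed.

Lemma balls_similar_net_class sim V W (G : mgraph M V) o (H : mgraph M W) p n :
  countable [set: V] -> countable [set: W] ->
  vert G o -> (forall n, finite_set (reach G o n)) ->
  vert H p -> (forall n, finite_set (reach H p n)) ->
  rooted_iso sim (ball_graph G o n) o (ball_graph H p n) p ->
  balls_similar sim n (net_class G o) (net_class H p).
Proof.
move=> cV cW oG fG pH fH iso.
have [N [x Nx]] := rooted_iso_nat (component G o) o cV.
have [K [y Ky]] := rooted_iso_nat (component H p) p cW.
have [xN isoN] := Nx (component_vert oG).
have [yK isoK] := Ky (component_vert pH).
exists (N, x), (K, y); rewrite !members_net_class//; split => /=.
- split=> //; split=> //=.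
  exact: rooted_iso_network isoN (component_network oG fG).
- split=> //; split=> //=.
  exact: rooted_iso_network isoK (component_network pH fH).
- have := rooted_iso_ball n (component_vert oG) isoN.
  have := rooted_iso_ball n (component_vert pH) isoK.
  rewrite !ball_component => bK bN.
  have bN' : rooted_iso eq (ball_graph N x n) x (ball_graph G o n) o.
    apply: rooted_iso_sym bN => //; split=> //.
    by apply: (@reach_le _ _ _ _ 0).
  apply: rooted_iso_trans bN' _; last first.
    by apply: rooted_iso_trans iso bK => a b c ab <-; exact: ab.
  by move=> a b c ->.
Qed.

(** The radius n + 1 belongs to the set whose supremum is alpha, so 1/(1 + alpha) is at most 1/(n +
    2); for infinite alpha the distance is 0. *)
Lemma gdist_balls_similar (C D : Gstar M) n :
  balls_similar (fun a b => @mdist R M a b < (n.+1%:R : R)^-1) n.+1 C D ->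
  gdist C D <= (n.+2%:R)^-1.
Proof.
move=> CD; rewrite /gdist.
have le : ((n.+1%:R)%:E <= gdist_sup C D)%E.
  apply: ereal_sup_ubound; exists n.+1%:R => //=.
  by split=> //; rewrite natrK.
have -> : (n.+2%:R : R) = 1 + n.+1%:R by rewrite -[n.+2]addn1 natrD addrC.
move: le; case: (gdist_sup C D) => [r| |//].
  rewrite lee_fin => nr; rewrite -EFinD inver ifF/=; last first.
    by rewrite gt_eqF// ltr_pwDl// (le_trans _ nr).
  by rewrite lef_pV2 ?posrE ?ltr_pwDl ?lerD2l// (le_trans _ nr).
by move=> _; rewrite addey// invey/=.
Qed.

End net_class.

(** * Measurability of the class of a random network *)

Section sigma_algebra_closure.
Context (T : Type) (F : set (set T)) (sF : sigma_algebra setT F).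
Implicit Types A B : T -> Prop.

(** The rules of this section follow connectives and countable quantifiers, so that measurability is
    read off the formula defining an event. The sigma-algebra is arbitrary because they serve both
    for [measurable] and for [graph_events]. *)
Lemma salgC A : F [set x | A x] -> F [set x | ~ A x].
Proof. by case: sF => _ FC _ FA; have := FC _ FA; rewrite setTD. Qed.

Lemma salg_cst (P : Prop) : F [set _ | P].
Proof.
case: (sF) => F0 FC _; have [p|p] := pselect P.
  rewrite (_ : [set _ | P] = setT `\` set0); first exact: FC.
  by apply/seteqP; split => // x _; split.
by rewrite (_ : [set _ | P] = set0)//; apply/seteqP; split.
Qed.

Lemma salg_ex (I : Type) (A : I -> T -> Prop) : countable [set: I] ->
  (forall i, F [set x | A i x]) -> F [set x | exists i, A i x].
Proof.
move=> cI FA; have /pcard_injP[pk] := cI; rewrite /= => pkI.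
have pk_inj : injective pk by move=> u v; apply: pkI; rewrite inE.
case: (sF) => _ _ Fb.
rewrite (_ : [set _ | _] = \bigcup_k [set x | exists2 i, pk i = k & A i x]).
  apply: Fb => k; have [[i ik]|h] := pselect (exists i, pk i = k).
    rewrite (_ : [set _ | _] = [set x | A i x])//.
    apply/seteqP; split => x /=; last by exists i.
    by rewrite -ik => -[j /pk_inj ->].
  rewrite (_ : [set _ | _] = [set _ | False]); first exact: salg_cst.
  by apply/seteqP; split => // x [i ik _]; case: h; exists i.
apply/seteqP; split => x /=; first by move=> [i Ai]; exists (pk i) => //;
  exists i.
by move=> [k _ [i _ Ai]]; exists i.
Qed.

Lemma salg_all (I : Type) (A : I -> T -> Prop) : countable [set: I] ->
  (forall i, F [set x | A i x]) -> F [set x | forall i, A i x].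
Proof.
move=> cI FA.
rewrite (_ : [set _ | _] = [set x | ~ exists i, ~ A i x]).
  by apply: salgC; apply: salg_ex => // i; apply: salgC.
apply/seteqP; split => x /=; first by move=> h [i]; apply.
by move=> h i; apply: contrapT => nA; apply: h; exists i.
Qed.

Lemma salgU A B : F [set x | A x] -> F [set x | B x] -> F [set x | A x \/ B x].
Proof.
move=> FA FB; pose C (b : bool) := if b then A else B.
rewrite (_ : [set _ | _] = [set x | exists b, C b x]).
  by apply: salg_ex => // -[].
apply/seteqP; split => x /=; first by move=> [|]; [exists true|exists false].
by move=> [[]]; [left|right].
Qed.

Lemma salgI A B : F [set x | A x] -> F [set x | B x] -> F [set x | A x /\ B x].
Proof.
move=> FA FB; pose C (b : bool) := if b then A else B.
rewrite (_ : [set _ | _] = [set x | forall b, C b x]).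
  by apply: salg_all => // -[].
apply/seteqP; split => x /=; first by move=> [? ?] [].
by move=> h; split; [apply: (h true)|apply: (h false)].
Qed.

Lemma salg_imp A B : F [set x | A x] -> F [set x | B x] ->
  F [set x | A x -> B x].
Proof.
move=> FA FB; rewrite (_ : [set _ | _] = [set x | ~ A x \/ B x]).
  by apply: salgU => //; apply: salgC.
apply/seteqP; split => x /=; last by case.
by move=> h; have [/h|] := pselect (A x); [right|left].
Qed.

Lemma salg_iff A B : F [set x | A x] -> F [set x | B x] ->
  F [set x | A x <-> B x].
Proof. by move=> FA FB; apply: salgI; apply: salg_imp. Qed.

End sigma_algebra_closure.

Lemma measurable_salg d (T : measurableType d) :
  sigma_algebra setT (@measurable d T).
Proof. exact: sigma_algebra_measurable. Qed.

Lemma countable_surj (T : Type) (A : set T) (x0 : T) : countable A ->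
  exists e : nat -> T, forall x, A x -> exists i, e i = x.
Proof.
move=> /pcard_injP[pk] /= pkI.
have /choice[e eP] : forall i, exists x, (exists2 y, A y & pk y = i) ->
    A x /\ pk x = i.
  move=> i; have [[y Ay yi]|h] := pselect (exists2 y, A y & pk y = i).
    by exists y.
  by exists x0.
exists e => x Ax; exists (pk x).
have [Ae ee] : A (e (pk x)) /\ pk (e (pk x)) = pk x by apply: eP; exists x.
by apply: pkI ee; rewrite inE.
Qed.

Lemma open_mdist_lt (R : realType) (M : metricType R) (a : M) (e : R) :
  open [set x | @mdist R M x a < e].
Proof.
rewrite openE => x /= xa; rewrite /interior.
apply: filterS (nbhsx_ballx x (e - mdist x a) _); last by rewrite subr_gt0.
move=> y; rewrite ballEmdist /= ltrBrDr => xy.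
by rewrite (le_lt_trans (metric_triangle _ x _))// (metric_sym y).
Qed.

Lemma dense_sequence (R : realType) (M : completeMetricType R) :
  separable M ->
  exists e : nat -> M, forall (x : M) (r : R), 0 < r ->
    exists i, mdist x (e i) < r.
Proof.
move=> [D cD dD]; have [e eP] := countable_surj point cD; exists e => x r r0.
have [y [+ yD]] : [set y | mdist y x < r] `&` D !=set0.
  by apply: dD; [exists x; rewrite /= mdistxx|exact: open_mdist_lt].
by have [i <-] := eP _ yD; exists i; rewrite metric_sym.
Qed.

Section measurable_net_class.
Context d (Omega : measurableType d) (R : realType) (M : completeMetricType R).
Context (M_separable : separable M).
Context (V : choiceType) (V_countable : countable [set: V]).
Context (G : Omega -> mgraph M V) (o : V).

Local Notation F := (graph_events G).

Let sF : sigma_algebra setT F. Proof. exact: smallest_sigma_algebra. Qed.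

Let F_vert u : F [set w | vert (G w) u].
Proof. by apply: sub_sigma_algebra; exists u, u, setT => //; constructor. Qed.

Let F_adj u v : F [set w | adj (G w) u v].
Proof. by apply: sub_sigma_algebra; exists u, v, setT => //; constructor 2. Qed.

Let F_vmark u a (e : R) :
  F [set w | vert (G w) u /\ mdist (vmark (G w) u) a < e].
Proof.
apply: sub_sigma_algebra; exists u, u, [set x | mdist x a < e].
  by apply: sub_sigma_algebra; exact: open_mdist_lt.
by constructor 3.
Qed.

Let F_emark u v a (e : R) :
  F [set w | adj (G w) u v /\ mdist (emark (G w) u v) a < e].
Proof.
apply: sub_sigma_algebra; exists u, v, [set x | mdist x a < e].
  by apply: sub_sigma_algebra; exact: open_mdist_lt.
by constructor 4.
Qed.

Let F_reach n u : F [set w | reach (G w) o n u].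
Proof.
elim: n u => [|n IH] u /=.
  exact: (salgI sF (salg_cst sF (u = o)) (F_vert u)).
apply: (salgU sF (IH u)).
rewrite (_ : [set _ | _] =
  [set w | exists v, reach (G w) o n v /\ adj (G w) v u]).
  by refine (salg_ex sF _ _) => // v; exact: (salgI sF).
by apply/seteqP; split => w [v]; [exists v|case; exists v].
Qed.

(** The outcomes on which the class is that of the component and not the default [point]. *)
Let good w := vert (G w) o /\ forall n, finite_set (reach (G w) o n).

Section cylinders.
Variables (dec : nat -> V) (dense_seq : nat -> M).
Hypothesis decP : forall u, exists a, dec a = u.
Hypothesis denseP : forall (x : M) (r : R), 0 < r ->
    exists i, mdist x (dense_seq i) < r.

(** Listing the ball explicitly turns its finiteness into a countable union over lists. *)
Let ball_eq n (s : seq nat) w :=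
  forall u, reach (G w) o n u <-> exists2 a, a \in s & dec a = u.

Let F_ball_eq n s : F [set w | ball_eq n s w].
Proof.
by refine (salg_all sF _ _) => // u; apply: (salg_iff sF) => //;
  exact: salg_cst.
Qed.

Let finite_ball_eq n w : finite_set (reach (G w) o n) <-> exists s,
  ball_eq n s w.
Proof.
split; last first.
  move=> [s sP]; apply: (sub_finite_set (B := dec @` [set` s])).
    by move=> u /sP[a]; exists a.
  exact: finite_image.
have /choice[cod codP] := decP.
move=> /finite_fsetP[X XP]; exists [seq cod u | u <- X] => u; rewrite XP.
split => [uX|[a /mapP[v vX ->] <-]].
  by exists (cod u) => //; apply/mapP; exists u.
by rewrite /= codP.
Qed.

Let F_good : F [set w | good w].
Proof.
apply: (salgI sF) => //; refine (salg_all sF _ _) => // n.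
rewrite (_ : [set _ | _] = [set w | exists s, ball_eq n s w]).
  by refine (salg_ex sF _ _) => //; exact: countableP.
by apply/seteqP; split => w /finite_ball_eq.
Qed.

(* On good outcomes, the preimage of an open set is a union of finite
   intersections of these countably many events. *)
Let J : Type := (((nat * seq nat) + (nat * nat * bool)) +
  ((nat * nat * nat) + (nat * nat * nat * nat)))%type.

Let basic (j : J) : set Omega :=
  match j with
  | inl (inl (n, s)) => ball_eq n s
  | inl (inr (a, b, t)) => [set w | adj (G w) (dec a) (dec b) <-> t]
  | inr (inl (a, i, k)) => [set w | vert (G w) (dec a) ->
      vert (G w) (dec a) /\
      mdist (vmark (G w) (dec a)) (dense_seq i) < k.+1%:R^-1]
  | inr (inr (a, b, i, k)) => [set w | adj (G w) (dec a) (dec b) ->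
      adj (G w) (dec a) (dec b) /\
      mdist (emark (G w) (dec a) (dec b)) (dense_seq i) < k.+1%:R^-1]
  end.

Let F_basic j : F [set w | basic j w].
Proof.
case: j => [[[n s]|[[a b] t]]|[[[a i] k]|[[[a b] i] k]]] /=.
- exact: F_ball_eq.
- by apply: (salg_iff sF) => //; exact: salg_cst.
- exact: (salg_imp sF).
- exact: (salg_imp sF).
Qed.

(** The ball of radius n + 1 is finite, so finitely many basic events fix its vertices and edges and
    approximate its marks by points of the dense sequence. Any other good outcome in these events
    has a similar ball. *)
Let cylinder_neighborhood w n : good w -> exists s : seq J,
  (forall j, j \in s -> basic j w) /\
  forall w', good w' -> (forall j, j \in s -> basic j w') ->
    gdist (net_class (G w) o) (net_class (G w') o) <= n.+2%:R^-1.
Proof.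
move=> gw; have [ow fw] := gw.
have /finite_ball_eq[s sP] := fw n.+1.
have k0 (k : nat) : 0 < (k.+1%:R : R)^-1 by rewrite invr_gt0.
(* Both marks are compared with the same dense point up to 1/(k + 1), and twice this is 1/(n + 1),
   the tolerance at radius n + 1. *)
pose k := (n.*2).+1.
have kk : (k.+1%:R : R)^-1 + k.+1%:R^-1 = n.+1%:R^-1.
  have -> : k.+1 = (2 * n.+1)%N by rewrite /k mul2n.
  by rewrite natrM invfM -mulrDl -[in LHS]div1r -splitr mul1r.
have /choice[q qP] : forall x : M, exists i,
    mdist x (dense_seq i) < (k.+1%:R : R)^-1 by move=> x; exact: denseP.
pose L1 : seq J :=
  [seq inl (inr (a, b, `[< adj (G w) (dec a) (dec b) >])) | a <- s, b <- s].
pose L2 : seq J := [seq inr (inl (a, q (vmark (G w) (dec a)), k)) | a <- s].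
pose L3 : seq J :=
  [seq inr (inr (a, b, q (emark (G w) (dec a) (dec b)), k)) | a <- s, b <- s].
exists (inl (inl (n.+1, s)) :: L1 ++ L2 ++ L3).
split=> [j|w' gw' bw'].
  rewrite inE !mem_cat => /or4P[/eqP -> //|/allpairsP[[a b] [_ _ ->]]|
    /mapP[a _ ->]|/allpairsP[[a b] [_ _ ->]]] //=.
  by split=> /asboolP.
have [ow' fw'] := gw'.
have sP' : ball_eq n.+1 s w'.
  by apply: (bw' (inl (inl (n.+1, s)))); rewrite inE eqxx.
have ball_adj a b : a \in s -> b \in s ->
    (adj (G w) (dec a) (dec b) <-> adj (G w') (dec a) (dec b)).
  move=> sa sb.
  have := bw' (inl (inr (a, b, `[< adj (G w) (dec a) (dec b) >]))).
  rewrite inE !mem_cat (_ : _ \in L1) ?orbT/=; last first.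
    by apply/allpairsP; exists (a, b).
  move=> /(_ isT) h.
  by split => [/asboolP/h|/h/asboolP].
apply/gdist_balls_similar/balls_similar_net_class => //.
have vb u : (vert (G w) `&` reach (G w) o n.+1) u <->
    exists2 a, a \in s & dec a = u.
  by rewrite -sP; split=> [[]//|h]; split=> //; exact: reach_vert h.
have vb' u : (vert (G w') `&` reach (G w') o n.+1) u <->
    exists2 a, a \in s & dec a = u.
  by rewrite -sP'; split=> [[]//|h]; split=> //; exact: reach_vert h.
(* Both balls have the vertex set listed by [s], so the identity is the isomorphism. *)
exists id; split => //.
- split => //; first by move=> u /vb /vb'.
  by move=> u /vb' /vb uw; exists u.
- move=> u v /vb[a sa <-] /vb[b sb <-]; split=> -[ab _ _]; split.
  + exact/(ball_adj _ _ sa sb).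
  + by apply/(sP' (dec a)); exists a.
  + by apply/(sP' (dec b)); exists b.
  + exact/(ball_adj _ _ sa sb).
  + by apply/(sP (dec a)); exists a.
  + by apply/(sP (dec b)); exists b.
- move=> u /vb[a sa <-].
  have := bw' (inr (inl (a, q (vmark (G w) (dec a)), k))).
  rewrite inE !mem_cat (_ : _ \in L2) ?orbT/=; last by apply/mapP; exists a.
  move=> /(_ isT).
  have [|aw' _ /(_ aw')[_ d2]] := (vb' (dec a)).2; first by exists a.
  rewrite -kk (le_lt_trans (metric_triangle _
    (dense_seq (q (vmark (G w) (dec a)))) _))//.
  by rewrite ltrD// metric_sym.
- move=> u v [uv /sP[a sa ea] /sP[b sb eb]]; rewrite -{}ea -{}eb in uv *.
  have := bw' (inr (inr (a, b, q (emark (G w) (dec a) (dec b)), k))).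
  rewrite inE !mem_cat (_ : _ \in L3) ?orbT/=; last first.
    by apply/allpairsP; exists (a, b).
  move=> /(_ isT).
  move=> /(_ ((ball_adj _ _ sa sb).1 uv))[_ d2].
  rewrite -kk (le_lt_trans (metric_triangle _
    (dense_seq (q (emark (G w) (dec a) (dec b)))) _))//.
  by rewrite ltrD// metric_sym.
Qed.

Let F_open_net_class (A : set (Gstar M)) : open A ->
  F [set w | A (net_class (G w) o)].
Proof.
move=> oA.
(* Collecting all lists whose intersection lies in the preimage keeps the union countable, although
   there may be uncountably many outcomes. *)
pose nbh (s : seq J) := forall w, good w -> (forall j, j \in s -> basic j w) ->
  A (net_class (G w) o).
rewrite (_ : [set _ | _] =
  [set w | (good w /\ exists s, nbh s /\ forall j, j \in s -> basic j w) \/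
           (~ good w /\ A point)]).
  apply: (salgU sF); apply: (salgI sF) => //.
  - refine (salg_ex sF _ _) => [|s]; first exact: countableP.
    apply: (salgI sF); first exact: salg_cst.
    refine (salg_all sF _ _) => [|j]; first exact: countableP.
    by apply: (salg_imp sF) => //; exact: salg_cst.
  - exact: (salgC sF).
  - exact: salg_cst.
apply/seteqP; split => w /=; last first.
  move=> [[gw [s [ns ws]]]|[ngw Ap]]; first exact: ns.
  by rewrite net_class_point.
have [gw Aw|ngw Aw] := pselect (good w); last first.
  by right; split => //; rewrite net_class_point in Aw.
left; split=> //; have [e e0 eA] := oA _ Aw.
have [n ne] : exists n, (n.+2%:R : R)^-1 < e.
  exists (Num.bound e^-1).
  rewrite invf_plt ?posrE// (lt_trans (archi_boundP _))// ?invr_ge0 ?ltW//.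
  by rewrite ltr_nat.
have [s [ws sn]] := cylinder_neighborhood n gw; exists s; split=> // w' gw' w's.
by apply: eA; rewrite (le_lt_trans (sn _ _ _)).
Qed.

Lemma graph_events_net_class_aux (A : set (Gstar M)) : measurable A ->
  F [set w | A (net_class (G w) o)].
Proof.
pose H := [set A : set (Gstar M) | F [set w | A (net_class (G w) o)]].
suff : <<s @open (Gstar M) >> `<=` H by apply.
apply: smallest_sub; last exact: F_open_net_class.
split => [|B HB|B HB].
- exact: (salg_cst sF False).
- by rewrite /H /= (_ : [set w | _] = [set w | ~ B (net_class (G w) o)]);
    [exact: (salgC sF) | apply/seteqP; split => w //= [] ].
- rewrite /H /= (_ : [set w | _] = [set w | exists i, B i (net_class (G w) o)]).
    exact: (salg_ex sF).
  by apply/seteqP; split => w [i]; [exists i|exists i].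
Qed.

End cylinders.

Lemma graph_events_net_class (A : set (Gstar M)) : measurable A ->
  F [set w | A (net_class (G w) o)].
Proof.
have [dec decP] := countable_surj o V_countable.
have [e eP] := dense_sequence M_separable.
by apply: (graph_events_net_class_aux (dec := dec)) eP _ => u; exact: decP.
Qed.

End measurable_net_class.

Lemma countable_prodT (T U : Type) :
  countable [set: T] -> countable [set: U] -> countable [set: T * U].
Proof. by move=> cT cU; rewrite -setXTT; exact: countableX. Qed.

(** * The bridge as a measurable random graph *)

Section bridge.
Context d (Omega : measurableType d) (R : realType).
Context (S : pointedType) (Xi : completeMetricType R).
Context (h : S * Xi -> S) (xi : int -> Omega -> Xi) (xs : S).

Lemma iter_f_plus_time w n t x : (iter n (f_plus h xi w) (t, x)).1 = t + n%:Z.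
Proof.
elim: n => [|n IH]; first by rewrite addr0.
by rewrite iterS /= IH -addrA -PoszD addn1.
Qed.

Lemma iter_f_plusS w n t x : (iter n.+1 (f_plus h xi w) (t, x)).2 =
  h ((iter n (f_plus h xi w) (t, x)).2, xi (t + n%:Z) w).
Proof. by rewrite iterS /= iter_f_plus_time. Qed.

(** Starting times are indexed by the delay n before the vertex. The constraint on times disappears
    into a countable existential, from which measurability and covariance under the shift are read
    off. *)
Lemma bridge_vertP w v : bridge_vert h xi xs w v <->
  exists n : nat, (iter n (f_plus h xi w) (v.1 - n%:Z, xs)).2 = v.2.
Proof.
case: v => s y; split=> [[t _ [r /= tr [<- <-]]]|[n /= <-]].
  exists `|r - t|%N; rewrite /doeblin_state gez0_abs ?subr_ge0//.
  by rewrite subKr.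
exists (s - n%:Z) => //; exists s; first by rewrite /= lerBlDr lerDl.
by rewrite /doeblin_state opprB addrC subrK.
Qed.

Lemma spine_bridge_vert w t : bridge_vert h xi xs w (t, xs).
Proof. by apply/bridge_vertP; exists 0%N. Qed.

End bridge.

Section bridge_measurability.
Context d (Omega : measurableType d) (R : realType).
Context (S : pointedType) (S_countable : countable [set: S]).
Context (Xi : completeMetricType R).
Context (h : S * Xi -> S).
Hypothesis h_measurable : measurable_fun setT
  (h : discreteType S * borelType Xi -> discreteType S).
Context (xi : int -> Omega -> Xi).
Hypothesis xi_measurable : forall t,
  measurable_fun setT (xi t : Omega -> borelType Xi).
Context (xs : S).

Let sO := measurable_salg Omega.

Let measurable_mark d' (T : measurableType d') (f : S * Xi -> T) z t C :
  measurable_fun setT (f : discreteType S * borelType Xi -> T) ->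
  measurable C -> measurable [set w | C (f (z, xi t w))].
Proof.
move=> mf mC.
have m : measurable_fun setT
    (fun w => (z, xi t w) : discreteType S * borelType Xi).
  by apply: measurable_fun_pair => //; exact: measurable_cst.
rewrite (_ : [set _ | _] = (fun w => (z, xi t w)) @^-1` (f @^-1` C))//.
rewrite -[X in measurable X]setTI; apply: m => //.
by rewrite -[X in measurable X]setTI; exact: mf.
Qed.

(** The state fed to [h] is random; splitting along its countably many values [z] leaves [h]
    evaluated at a fixed state. *)
Lemma measurable_iter_f_plus n t x y :
  measurable [set w | (iter n (f_plus h xi w) (t, x)).2 = y].
Proof.
elim: n y => [|n IH] y; first exact: (salg_cst sO (x = y)).
rewrite (_ : [set _ | _] = [set w | exists z,
  (iter n (f_plus h xi w) (t, x)).2 = z /\ h (z, xi (t + n%:Z) w) = y]).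
  apply: (salg_ex sO) => // z; apply: (salgI sO) => //.
  refine (@measurable_mark _ (discreteType S) h z _ [set y] _ _) => //.
  exact: sub_sigma_algebra.
apply/seteqP; split => w; rewrite /mkset iter_f_plusS.
  by move=> <-; eexists.
by move=> [z [<-]].
Qed.

Lemma measurable_bridge_vert v : measurable [set w | bridge_vert h xi xs w v].
Proof.
rewrite (_ : [set _ | _] = [set w | exists n : nat,
    (iter n (f_plus h xi w) (v.1 - n%:Z, xs)).2 = v.2]).
  by apply: (salg_ex sO) => // n; exact: measurable_iter_f_plus.
by apply/seteqP; split => w /bridge_vertP.
Qed.

Let measurable_spined_edge u v : measurable [set w | spined_edge h xi xs w u v].
Proof.
apply: (salgU sO); last exact: (salg_cst sO).
apply: (salgI sO); first exact: measurable_bridge_vert.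
rewrite (_ : [set _ | _] =
    [set w | v.1 = u.1 + 1 /\ h (u.2, xi u.1 w) = v.2]).
  apply: (salgI sO); first exact: (salg_cst sO).
  refine (@measurable_mark _ (discreteType S) h u.2 _ [set v.2] _ _) => //.
  exact: sub_sigma_algebra.
apply/seteqP; split => w /=; rewrite /f_plus; first by move=> ->.
by case: v => t y /= [-> ->].
Qed.

Context (M : completeMetricType R) (M_separable : separable M).
Context (iota : S * Xi -> M).
Hypothesis iota_measurable : measurable_fun setT
  (iota : discreteType S * borelType Xi -> borelType M).
Context (kappa : bool -> M).

Local Notation bar := (bar_bridge h xi xs iota kappa).
Local Notation bar_window := (bar_bridge_window h xi xs iota kappa).

Let measurable_adj u v : measurable [set w | adj (bar w) u v].
Proof. by apply: (salgU sO); exact: measurable_spined_edge. Qed.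

Let measurable_emark u v (C : set M) :
  measurable [set w | C (emark (bar w) u v)].
Proof.
rewrite (_ : [set _ | _] =
  [set w | (spined_edge h xi xs w u v /\ C (kappa true)) \/
           (~ spined_edge h xi xs w u v /\ C (kappa false))]).
  apply: (salgU sO); apply: (salgI sO).
  - exact: measurable_spined_edge.
  - exact: (salg_cst sO).
  - by apply: (salgC sO); exact: measurable_spined_edge.
  - exact: (salg_cst sO).
apply/seteqP; split => w /=.
  by case: asboolP => [? ?|? ?]; [left|right].
by move=> [[/asboolT ->]|[/asboolF ->]].
Qed.

Lemma graph_events_bar_bridge : graph_events bar `<=` measurable.
Proof.
apply: smallest_sub => // _ [u [v [C mC]]] [] ->.
- exact: measurable_bridge_vert.
- exact: measurable_adj.
- apply: (salgI sO); first exact: measurable_bridge_vert.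
  exact: (@measurable_mark _ (borelType M) iota u.2).
- exact: (salgI sO).
Qed.

Lemma graph_events_bar_bridge_window I :
  graph_events (bar_window I) `<=` measurable.
Proof.
have mwin v : measurable [set w | bridge_window h xi xs I w v].
  by apply: (salgI sO); [exact: measurable_bridge_vert|exact: (salg_cst sO)].
have madj u v : measurable [set w | adj (bar_window I w) u v].
  rewrite (_ : [set _ | _] = [set w | adj (bar w) u v /\
      (bridge_window h xi xs I w u /\ bridge_window h xi xs I w v)]).
    by apply: (salgI sO) => //; exact: (salgI sO).
  by apply/seteqP; split => w /=; [case|move=> [? []]].
have mvert u : measurable [set w | vert (bar_window I w) u].
  by apply: (salgI sO) => //; exact: measurable_bridge_vert.
apply: smallest_sub => // _ [u [v [C mC]]] [] -> //.
- apply: (salgI sO) => //.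
  exact: (@measurable_mark _ (borelType M) iota u.2).
- by apply: (salgI sO) => //; exact: measurable_emark.
Qed.

Lemma measurable_net_class_bar_bridge v :
  measurable_fun setT (fun w => net_class (bar w) v : Gstar M).
Proof.
move=> _ A mA; rewrite setTI; apply: graph_events_bar_bridge.
by apply: graph_events_net_class mA => //;
  exact: (countable_prodT (countableP _) S_countable).
Qed.

Lemma measurable_net_class_bar_bridge_window I v :
  measurable_fun setT (fun w => net_class (bar_window I w) v : Gstar M).
Proof.
move=> _ A mA; rewrite setTI; apply: (graph_events_bar_bridge_window (I := I)).
by apply: graph_events_net_class mA => //;
  exact: (countable_prodT (countableP _) S_countable).
Qed.

End bridge_measurability.

(** * Path space *)

Section path_space.
Context (Xi : ptopologicalType).

Definition path_generators : set (set (int -> Xi)) :=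
  [set A | exists (t : int) (C : set (borelType Xi)),
     measurable C /\ A = [set x | C (x t)]].

(** Its measurable sets are the [product_events] in terms of which [stationary] and [ergodic] are
    stated. *)
Definition path := g_sigma_algebraType path_generators.

Definition coord (t : int) (x : path) : Xi := x t.

Definition shiftn (k : int) (x : path) : path := fun t => x (t + k).

Lemma shiftn0 x : shiftn 0 x = x.
Proof. by apply/funext => t; rewrite /shiftn addr0. Qed.

Lemma shiftnD j k x : shiftn j (shiftn k x) = shiftn (j + k) x.
Proof. by apply/funext => t; rewrite /shiftn addrA. Qed.

Lemma measurable_coord t : measurable_fun setT (coord t : path -> borelType Xi).
Proof.
move=> _ C mC; rewrite setTI; apply: sub_sigma_algebra; exists t, C; by split.
Qed.

Lemma measurable_path d (T : measurableType d) (F : T -> path) :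
  (forall t, measurable_fun setT (fun w => F w t : borelType Xi)) ->
  measurable_fun setT F.
Proof.
move=> mF; apply: (@measurability _ _ T path setT F path_generators) => //.
move=> _ [_ [t [C [mC ->]]] <-].
exact: mF.
Qed.

Lemma measurable_shiftn k : measurable_fun setT (shiftn k).
Proof. by apply: measurable_path => t; exact: (measurable_coord (t + k)). Qed.

End path_space.

Section path_law.
Context d (Omega : measurableType d) (R : realType) (P : probability Omega R).
Context (Xi : ptopologicalType) (xi : int -> Omega -> Xi).
Hypothesis xi_measurable : forall t,
  measurable_fun setT (xi t : Omega -> borelType Xi).

Lemma measurable_trajectory :
  measurable_fun setT (trajectory xi : Omega -> path Xi).
Proof. exact: measurable_path. Qed.

Definition path_law : probability (path Xi) R :=
  distribution P (mfun_Sub (mem_set measurable_trajectory : _ \in mfun)).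

Lemma ge0_integral_path_law (f : path Xi -> \bar R) : measurable_fun setT f ->
  (forall x, 0 <= f x)%E ->
  (\int[path_law]_x f x = \int[P]_w f (trajectory xi w))%E.
Proof.
move=> mf f0; rewrite ge0_integral_pushforward//; exact: measurable_trajectory.
Qed.

Lemma ae_path_law (A : path Xi -> Prop) : {ae path_law, forall x, A x} ->
  {ae P, forall w, A (trajectory xi w)}.
Proof.
move=> [N [mN N0 AN]]; exists (trajectory xi @^-1` N); split => //.
  by rewrite -[X in measurable X]setTI; exact: measurable_trajectory.
by move=> w /= /AN.
Qed.

Lemma path_law_shift : stationary P xi -> forall k (A : set (path Xi)),
  measurable A -> path_law (shiftn k @^-1` A) = path_law A.
Proof.
move=> st; have pos n (A : set (path Xi)) : measurable A ->
    path_law (shiftn n%:Z @^-1` A) = path_law A.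
  elim: n A => [|n IH] A mA.
    by congr (path_law _); apply/funext => x; rewrite /preimage /mkset shiftn0.
  rewrite -addn1 PoszD -[RHS](st A)// -[RHS](IH (shiftn 1 @^-1` A)); last first.
    by rewrite -[X in measurable X]setTI; exact: measurable_shiftn.
  congr (path_law _); apply/funext => x.
  by rewrite /preimage /mkset/= addrC -shiftnD.
move=> [n|n] A mA; first exact: pos.
(* A backward shift is undone by the forward shift of the same length, whose invariance is already
   known. *)
rewrite -(pos n.+1) //; last first.
  by rewrite -[X in measurable X]setTI; exact: measurable_shiftn.
congr (path_law _); apply/funext => x; rewrite /preimage /mkset shiftnD.
by rewrite NegzE addNr shiftn0.
Qed.

Lemma path_law_ergodic : ergodic P xi -> forall A : set (path Xi),
  measurable A -> shiftn 1 @^-1` A = A -> path_law A = 0%E \/ path_law A = 1%E.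
Proof. by move=> er A mA sA; exact: er. Qed.

End path_law.

Section bridge_path.
Context d (Omega : measurableType d) (R : realType).
Context (S : pointedType) (Xi : completeMetricType R).
Context (h : S * Xi -> S) (xi : int -> Omega -> Xi) (xs : S).
Context (M : completeMetricType R) (iota : S * Xi -> M) (kappa : bool -> M).

Local Notation coord := (@coord Xi).

Lemma bar_bridge_path w : bar_bridge h xi xs iota kappa w =
  bar_bridge h coord xs iota kappa (trajectory xi w).
Proof. exact: mgraph_eq. Qed.

Lemma bar_bridge_window_path I w : bar_bridge_window h xi xs iota kappa I w =
  bar_bridge_window h coord xs iota kappa I (trajectory xi w).
Proof. exact: mgraph_eq. Qed.

Implicit Types (x : path Xi).

Local Notation step x := (f_plus h coord x).
Local Notation bar := (bar_bridge h coord xs iota kappa).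
Local Notation bar_window := (bar_bridge_window h coord xs iota kappa).

Lemma iter_f_plus_shift k x n t y :
  (iter n (step (shiftn k x)) (t, y)).2 = (iter n (step x) (t + k, y)).2.
Proof.
elim: n => [//|n IH]; rewrite !iter_f_plusS IH.
by rewrite /coord /shiftn addrAC.
Qed.

Lemma bridge_vert_shift k x v :
  bridge_vert h coord xs (shiftn k x) v <->
  bridge_vert h coord xs x (v.1 + k, v.2).
Proof.
rewrite !bridge_vertP; split => -[n e]; exists n; move: e;
  by rewrite iter_f_plus_shift /= addrAC.
Qed.

Lemma bridge_states_shift k x t :
  bridge_states h coord xs (shiftn k x) t = bridge_states h coord xs x (t + k).
Proof. apply/seteqP; split => y h1;
  [exact: (bridge_vert_shift k x (t, y)).1 |
    exact: (bridge_vert_shift k x (t, y)).2]. Qed.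

Let shift_vertex (k : int) (v : int * S) : int * S := (v.1 + k, v.2).

Let shift_vertex_inj k : injective (shift_vertex k).
Proof. by move=> [t y] [s z] [/addIr -> ->]. Qed.

Let spined_edge_shift k x u v :
  spined_edge h coord xs (shiftn k x) u v <->
  spined_edge h coord xs x (shift_vertex k u) (shift_vertex k v).
Proof.
have eqv a b : v = (a, b) <-> shift_vertex k v = (a + k, b).
  split=> [-> //|e]; apply: (@shift_vertex_inj k); exact: e.
rewrite /spined_edge /bridge_edge /spine_edge /f_plus !eqv /= bridge_vert_shift.
by rewrite /coord /shiftn addrAC.
Qed.

(** The mark of a vertex records its state and driving value but not its time, so a translation in
    time is an isomorphism of networks. *)
Lemma net_class_bar_bridge_shift k x v : bridge_vert h coord xs (shiftn k x) v
  ->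
  net_class (bar (shiftn k x)) v = net_class (bar x) (v.1 + k, v.2).
Proof.
move=> vB; apply: net_class_iso => //; apply: rooted_iso_component => //.
exists (shift_vertex k); split => //=.
- split=> [u /bridge_vert_shift//|u w _ _ /shift_vertex_inj//|u uB].
  exists (u.1 - k, u.2); last by case: (u) => t y;
    rewrite /shift_vertex /= subrK.
  by apply/bridge_vert_shift; rewrite /= subrK; case: (u) uB.
- by move=> u w _ _; rewrite !spined_edge_shift.
- by move=> u w _; congr kappa; apply: asbool_equiv_eq;
    exact: spined_edge_shift.
Qed.

Lemma net_class_bar_bridge_window_shift k x (I J : set int) v :
  (forall t, I t <-> J (t + k)) ->
  bridge_window h coord xs I (shiftn k x) v ->
  net_class (bar_window I (shiftn k x)) v =
  net_class (bar_window J x) (v.1 + k, v.2).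
Proof.
move=> IJ vB; apply: net_class_iso; first by split => //; case: vB.
apply: rooted_iso_component; first by split => //; case: vB.
apply: (@rooted_iso_induced _ _ _ _ _ _ _ _ _ _ (shift_vertex k)) => //.
- split=> [u /bridge_vert_shift//|u w _ _ /shift_vertex_inj//|u uB].
  exists (u.1 - k, u.2); last by case: (u) => t y;
    rewrite /shift_vertex /= subrK.
  by apply/bridge_vert_shift; rewrite /= subrK; case: (u) uB.
- by move=> u w _ _; rewrite /= !spined_edge_shift.
- by move=> u w _ _ _; congr kappa; apply: asbool_equiv_eq;
    exact: spined_edge_shift.
- by move=> u uB; rewrite /bridge_window /= bridge_vert_shift IJ.
Qed.

End bridge_path.

(** * Birkhoff's ergodic theorem *)

Section measure_preserving.
Context d (X : measurableType d) (R : realType) (Q : {measure set X -> \bar R}).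
Context (T : X -> X) (mT : measurable_fun setT T).
Hypothesis TQ : forall A, measurable A -> Q (T @^-1` A) = Q A.

Lemma integral_pushforward_preserving (g : X -> \bar R) :
  (\int[pushforward Q T]_x g x = \int[Q]_x g x)%E.
Proof.
apply: (eq_measure_integral Q
  (m1 := measure_function_pushforward__canonical__measure_function_Measure Q
    mT)).
by move=> A mA _ /=; rewrite /pushforward TQ.
Qed.

Lemma ge0_integral_preserving (g : X -> \bar R) : measurable_fun setT g ->
  (forall x, 0 <= g x)%E -> (\int[Q]_x g (T x) = \int[Q]_x g x)%E.
Proof.
move=> mg g0.
by rewrite -[RHS]integral_pushforward_preserving ge0_integral_pushforward.
Qed.

Lemma integrable_preserving (g : X -> \bar R) :
  Q.-integrable setT g -> Q.-integrable setT (g \o T).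
Proof.
move=> /integrableP[mg ig]; apply/integrableP; split.
  exact: measurableT_comp.
rewrite -[X in (X < _)%E]/(\int[Q]_x (abse \o g) (T x))%E.
rewrite ge0_integral_preserving => [//||x]; first exact: measurableT_comp.
exact: abse_ge0.
Qed.

Lemma integral_preserving (g : X -> \bar R) : Q.-integrable setT g ->
  (\int[Q]_x g (T x) = \int[Q]_x g x)%E.
Proof.
move=> ig; have /integrableP[mg _] := ig.
rewrite -[RHS]integral_pushforward_preserving integral_pushforward//.
exact: (integrable_preserving ig).
Qed.

End measure_preserving.

Section birkhoff.
Context d (X : measurableType d) (R : realType) (Q : probability X R).
Context (T : X -> X) (mT : measurable_fun setT T).
Hypothesis TQ : forall A, measurable A -> Q (T @^-1` A) = Q A.
Hypothesis T_ergodic : forall A, measurable A -> T @^-1` A = A ->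
  Q A = 0%E \/ Q A = 1%E.

Definition birkhoff_sum (f : X -> R) n x := \sum_(i < n) f (iter i T x).

Lemma birkhoff_sumS f n x :
  birkhoff_sum f n.+1 x = f x + birkhoff_sum f n (T x).
Proof.
rewrite /birkhoff_sum big_ord_recl /=; congr (_ + _); apply: eq_bigr => i _.
by rewrite -iterSr.
Qed.

(* [max (0, S_1 x, ..., S_n x)], in the recursive form [M_(n+1) = max (0, f +
   M_n \o T)] on which the maximal ergodic theorem rests. *)
Fixpoint max_birkhoff_sum (f : X -> R) n x :=
  if n is m.+1 then Num.max 0 (f x + max_birkhoff_sum f m (T x)) else 0.

Lemma max_birkhoff_sum_ge0 f n x : 0 <= max_birkhoff_sum f n x.
Proof. by case: n => //= n; rewrite le_max lexx. Qed.

Lemma birkhoff_sum_le_max f n x : birkhoff_sum f n x <= max_birkhoff_sum f n x.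
Proof.
elim: n x => [|n IH] x; first by rewrite /birkhoff_sum big_ord0.
by rewrite birkhoff_sumS /= le_max lerD2l IH orbT.
Qed.

Lemma max_birkhoff_sumS f n x : max_birkhoff_sum f n x <= max_birkhoff_sum f
  n.+1 x.
Proof.
elim: n x => [|n IH] x; first exact: max_birkhoff_sum_ge0.
rewrite /= ge_max le_max lexx /= le_max; apply/orP; right.
by rewrite lerD2l; exact: IH.
Qed.

Lemma max_birkhoff_sum_le f m n x : (m <= n)%N ->
  max_birkhoff_sum f m x <= max_birkhoff_sum f n x.
Proof.
move=> /subnKC <-; elim: (n - m)%N => [|k IH]; first by rewrite addn0.
by rewrite addnS (le_trans IH)// max_birkhoff_sumS.
Qed.

Section maximal.
Variable f : X -> R.
Hypothesis int_f : Q.-integrable setT (EFin \o f).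

Let mf : measurable_fun setT f.
Proof. by apply/measurable_EFinP; exact: measurable_int int_f. Qed.

Let measurable_max n : measurable_fun setT (max_birkhoff_sum f n).
Proof.
elim: n => [|n IH] /=; first exact: measurable_cst.
apply: measurable_maxr => //; apply: measurable_funD => //.
exact: measurableT_comp.
Qed.

Let integrable_max n : Q.-integrable setT (EFin \o max_birkhoff_sum f n).
Proof.
elim: n => [|n IH].
  by rewrite (_ : _ \o _ = cst 0%E)//; exact: integrable0.
apply: (@le_integrable _ _ _ _ _ _ _
  ((EFin \o f) \+ ((EFin \o max_birkhoff_sum f n) \o T))%E) => //.
- by apply/measurable_EFinP; exact: measurable_max.
- move=> x _ /=; rewrite lee_fin maxC ger0_norm ?le_max ?lexx ?orbT//.
  by rewrite ge_max normr_ge0 ler_norm.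
- by apply: integrableD => //; exact: integrable_preserving IH.
Qed.

Let unbounded := [set x | forall B : nat, exists n,
  B%:R < max_birkhoff_sum f n x].

Let measurable_unbounded : measurable unbounded.
Proof.
apply: (salg_all (measurable_salg X)) => // B.
apply: (salg_ex (measurable_salg X)) => // n.
rewrite (_ : [set _ | _] = max_birkhoff_sum f n @^-1` `]B%:R, +oo[%classic).
  by rewrite -[X in measurable X]setTI; exact: measurable_max.
by apply/seteqP; split => x /=; rewrite in_itv/= andbT.
Qed.

(** By the recursion for the maxima, those at [x] and at [T x] are bounded or unbounded together, as
    they differ through the finite quantity [f x]. The invariance is exact, which is the form that
    [T_ergodic] accepts. *)
Let unbounded_invariant : T @^-1` unbounded = unbounded.
Proof.
apply/seteqP; split => x /= h B.
- have [n Bn] := h (Num.bound (`|B%:R - f x|)); exists n.+1 => /=.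
  rewrite lt_max; apply/orP; right; rewrite -ltrBlDl.
  apply: le_lt_trans Bn; rewrite (le_trans (ler_norm _))// ltW//.
  by rewrite archi_boundP.
- have [n Bn] := h (Num.bound (`|B%:R + f x|)); exists n.
  move: Bn; case: n => [|n /=].
    by rewrite /= ltNge ler0n.
  rewrite lt_max => /orP[|h1]; first by rewrite ltNge ler0n.
  apply: lt_le_trans (max_birkhoff_sumS f n (T x)).
  rewrite -(ltrD2l (f x)); apply: le_lt_trans h1.
  rewrite addrC (le_trans (ler_norm _))// ltW//.
  by rewrite archi_boundP.
Qed.

(* On the event that the maxima are unbounded, [M_(n+1) - M_n \o T] converges
   to [f] and is dominated by [|f|], while its integral is nonnegative. *)
Let integral_ge0_of_unbounded : Q unbounded = 1%E ->
  (0 <= \int[Q]_x (f x)%:E)%E.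
Proof.
move=> Q1.
have ae_unbounded : {ae Q, forall x, unbounded x}.
  exists (~` unbounded); split => //; first exact: measurableC.
  by rewrite probability_setC// Q1 subee.
pose g n x := (max_birkhoff_sum f n.+1 x - max_birkhoff_sum f n (T x)).
have gE n x : g n x = Num.max (- max_birkhoff_sum f n (T x)) (f x).
  by rewrite /g /= addr_maxl sub0r addrK.
have gf n x : `|g n x| <= `|f x|.
  rewrite gE ler_norml; apply/andP; split.
    rewrite le_max; apply/orP; right; rewrite lerNl.
    by rewrite -normrN ler_norm.
  rewrite ge_max ler_norm andbT (le_trans _ (normr_ge0 _))// oppr_le0.
  exact: max_birkhoff_sum_ge0.
have mg n : measurable_fun setT (EFin \o g n).
  apply/measurable_EFinP; apply: measurable_funB => //.
  by apply: measurableT_comp.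
have [|||| _ _] := @dominated_convergence _ _ _ Q _ measurableT
  (fun n => EFin \o g n) (EFin \o f) (EFin \o (fun x => `|f x|)) mg.
- exact/measurable_EFinP.
(* As soon as the maximum at [T x] exceeds |f x|, the expression in [gE] equals [f x]; the sequence
   is eventually constant. *)
- apply: filterS ae_unbounded => x ux _; apply: cvg_near_cst.
  have Tx : unbounded (T x) by rewrite
    -[unbounded (T x)]/((T @^-1` unbounded) x) unbounded_invariant.
  have [n0 hn0] := Tx (Num.bound `|f x|).
  exists n0 => // n /= nn0; congr EFin; rewrite gE max_r//.
  rewrite lerNl (le_trans _ (max_birkhoff_sum_le _ _ nn0))// ltW//.
  apply: lt_trans hn0; rewrite (le_lt_trans (ler_norm _))// normrN.
  by rewrite archi_boundP.
- exact: integrable_norm.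
- by apply: aeW => x n _ /=; rewrite lee_fin.
(* Invariance of [Q] removes [T] from the second integral; the difference is then nonnegative
   because the maxima increase with n. *)
have -> : [sequence (\int[Q]_(x in [set: X]) (EFin \o g n) x)%E]_n =
    (fun n => (\int[Q]_x (max_birkhoff_sum f n.+1 x)%:E -
              \int[Q]_x (max_birkhoff_sum f n x)%:E)%E).
  apply/funext => n.
  rewrite -(integral_preserving mT TQ (g := EFin \o max_birkhoff_sum f n))//.
  rewrite -(integralB measurableT (integrable_max n.+1))//.
  exact: (integrable_preserving mT TQ (integrable_max n)).
move=> h; rewrite -(cvg_lim _ h)//; apply: lime_ge.
  by apply/cvg_ex; eexists; exact: h.
apply: nearW => n; rewrite sube_ge0 ?integrable_fin_num//.
apply: ge0_le_integral => //.
- by move=> x _; rewrite lee_fin max_birkhoff_sum_ge0.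
- exact/measurable_EFinP/measurable_max.
- exact/measurable_EFinP/measurable_max.
- by move=> x _; rewrite lee_fin max_birkhoff_sumS.
- exact: integrable_max.
- exact: integrable_max.
Qed.

Lemma max_birkhoff_sum_bounded : (\int[Q]_x (f x)%:E < 0)%E ->
  {ae Q, forall x, exists B : R, forall n, max_birkhoff_sum f n x <= B}.
Proof.
move=> f0.
have [Q0|/integral_ge0_of_unbounded] :=
    T_ergodic measurable_unbounded unbounded_invariant;
      last by rewrite leNgt f0.
exists unbounded; split => // x /= nb B; apply: contrapT => h; apply: nb.
exists B%:R => n; rewrite leNgt; apply/negP => Bn; by apply: h; exists n.
Qed.

End maximal.

(** The function f - (m + e) has mean -e < 0, so its Birkhoff sums are almost surely bounded above;
    C is this random bound. *)
Lemma birkhoff_sum_upper (f : X -> R) (m e : R) : 0 < e ->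
  Q.-integrable setT (EFin \o f) -> (\int[Q]_x (f x)%:E = m%:E)%E ->
  {ae Q, forall x, exists C, forall n,
    birkhoff_sum f n x <= n%:R * (m + e) + C}.
Proof.
move=> e0 intf fm; pose g x := f x - (m + e).
have intc : Q.-integrable setT (EFin \o cst (m + e)).
  exact: finite_measure_integrable_cst.
have intg : Q.-integrable setT (EFin \o g).
  exact: (integrableB measurableT intf intc).
have g0 : (\int[Q]_x (g x)%:E < 0)%E.
  have -> : (\int[Q]_x (g x)%:E =
      \int[Q]_x ((EFin \o f) x - (EFin \o cst (m + e)%R) x))%E by [].
  rewrite integralB// fm -[X in (_ - X)%E]/(\int[Q]_x (cst (m + e)%:E) x)%E.
  rewrite integral_cst//= probability_setT mule1 -EFinB.
  by rewrite lte_fin opprD addNKr oppr_lt0.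
apply: filterS (max_birkhoff_sum_bounded intg g0) => x [B HB]; exists B => n.
rewrite -lerBlDl (le_trans _ (HB n))//
  (le_trans _ (birkhoff_sum_le_max _ _ _))//.
by rewrite /birkhoff_sum /g sumrB sumr_const card_ord
  -[in X in _ <= X]mulr_natl.
Qed.

(** An error bound n e + C valid for every n is preferred to a limit: a window will be split into
    two pieces, one of which may stay short, and such bounds add up. The lower half is the upper
    bound for -f, and running e through 1/(k + 1) leaves a single null set. *)
Lemma birkhoff (f : X -> R) (m : R) :
  Q.-integrable setT (EFin \o f) -> (\int[Q]_x (f x)%:E = m%:E)%E ->
  {ae Q, forall x, forall e, 0 < e ->
    exists C, forall n, `|birkhoff_sum f n x - n%:R * m| <= n%:R * e + C}.
Proof.
move=> intf fm.
have intNf : Q.-integrable setT (EFin \o (fun x => - f x)).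
  exact: (integrableN intf).
have Nfm : (\int[Q]_x (- f x)%:E = (- m)%:E)%E.
  by rewrite -[RHS]/(- m%:E)%E -fm -integralN//= integrable_add_def.
have inv0 k : 0 < (k.+1%:R : R)^-1 by rewrite invr_gt0.
have up : {ae Q, forall x, forall k : nat, exists C, forall n,
    birkhoff_sum f n x <= n%:R * (m + k.+1%:R^-1) + C}.
  by apply/ae_foralln => k; exact: birkhoff_sum_upper.
have low : {ae Q, forall x, forall k : nat, exists C, forall n,
    birkhoff_sum (fun x => - f x) n x <= n%:R * (- m + k.+1%:R^-1) + C}.
  by apply/ae_foralln => k; exact: birkhoff_sum_upper.
apply: filterS2 up low => x up low e e0.
have [k ke] : exists k : nat, (k.+1%:R : R)^-1 < e.
  exists (Num.bound e^-1).
  rewrite invf_plt ?posrE// (lt_trans (archi_boundP _))// ?invr_ge0 ?ltW//.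
  by rewrite ltr_nat.
have [C HC] := up k; have [C' HC'] := low k.
exists (Num.max C C') => n; rewrite ler_norml; apply/andP; split.
- have := HC' n; rewrite /birkhoff_sum sumrN => h.
  rewrite -lerN2 opprB opprK (le_trans _ (_ : n%:R * k.+1%:R^-1 + C' <= _))//.
    rewrite addrC; move: h; rewrite mulrDr mulrN -addrA => h.
    by rewrite -[X in X <= _]addrC -lerBrDl [X in _ <= X]addrC.
  by rewrite lerD// ?le_max ?lexx ?orbT// ler_wpM2l// ltW.
- rewrite lerBlDl (le_trans (HC n))// mulrDr -addrA lerD2l lerD//.
    by rewrite ler_wpM2l// ltW.
  by rewrite le_max lexx.
Qed.

End birkhoff.

(** * Expected size of the bridge *)

Section countable_esum.
Context (R : realType).

(** Reduces sums over a countable type to series, which can be integrated term by term. The value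
    [None] pads the enumeration, since the injection into [nat] may miss integers. *)
Lemma countable_esum (I : choiceType) : countable [set: I] ->
  exists dec : nat -> option I, forall a : I -> \bar R,
    (forall i, 0 <= a i)%E ->
    (\esum_(i in [set: I]) a i = \sum_(n <oo) oapp a 0 (dec n))%E.
Proof.
move=> cI; have /pcard_injP[pk] := cI; rewrite /= => pkI.
have pk_inj : injective pk by move=> u v; apply: pkI; rewrite inE.
have /choice[dec decP] : forall n, exists o,
  (forall i, pk i = n -> o = Some i) /\
    ((~ exists i, pk i = n) -> o = None).
  move=> n; have [[i <-]|h] := pselect (exists i, pk i = n).
    by exists (Some i); split => [j /pk_inj ->//|]; case; exists i.
  by exists None; split => [i e|//]; case: h; exists i.
exists dec => a a0; rewrite nneseries_esumT; last first.
  by move=> n; case: (dec n) => [i|] /=.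
rewrite (_ : (fun n => _) = (fun n => if n \in range pk then oapp a 0%E (dec n)
  else 0%E)).
  rewrite -(esum_mkcond (range pk) (fun n => oapp a 0%E (dec n))).
  rewrite esum_image; last by move=> i j _ _ /pk_inj.
  by apply: eq_esum => i _; rewrite ((decP (pk i)).1 i).
apply/funext => n; case: ifPn => //; rewrite notin_setE => h.
by rewrite (decP n).2// => -[i pin]; apply: h; exists i.
Qed.

Context d (T : measurableType d) (mu : {measure set T -> \bar R}).
Context (I : choiceType) (I_countable : countable [set: I]).
Context (a : I -> T -> \bar R).
Hypothesis ma : forall i, measurable_fun setT (a i).
Hypothesis a0 : forall i x, (0 <= a i x)%E.

Let measurable_oapp o : measurable_fun setT
  (fun x => oapp (fun i => a i x) 0%E o).
Proof. by case: o => [i|] //=; exact: ma. Qed.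

Lemma measurable_countable_esum :
  measurable_fun setT (fun x => \esum_(i in [set: I]) a i x)%E.
Proof.
have [dec decE] := countable_esum I_countable.
rewrite (_ : (fun x => _) = fun x =>
  (\sum_(n <oo) oapp (fun i => a i x) 0 (dec n))%E).
  apply: ge0_emeasurable_sum => // n x _ _.
  by case: (dec n) => [i|] /=.
by apply/funext => x; apply: decE.
Qed.

Lemma integral_countable_esum :
  (\int[mu]_x (\esum_(i in [set: I]) a i x) =
   \esum_(i in [set: I]) \int[mu]_x a i x)%E.
Proof.
have [dec decE] := countable_esum I_countable.
rewrite decE; last by move=> i; exact: integral_ge0.
under eq_integral do rewrite decE//.
rewrite integral_nneseries//; last by move=> n x _; case: (dec n) => [i|] /=.
apply: eq_eseriesr => n _; case: (dec n) => [i|] //=.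
by rewrite integral0.
Qed.

End countable_esum.

(* Unlike [ge0_le_integral], no measurability is needed: the integral of a
   nonnegative function is a supremum over the simple functions below it. *)
Lemma le_integral_nonmeasurable d (T : measurableType d) (R : realType)
    (mu : {measure set T -> \bar R}) (f g : T -> \bar R) :
  (forall x, 0 <= f x)%E -> (forall x, f x <= g x)%E ->
  (\int[mu]_x f x <= \int[mu]_x g x)%E.
Proof.
move=> f0 fg; have g0 x : (0 <= g x)%E by exact: le_trans (fg x).
rewrite !ge0_integralTE//; apply: le_ereal_sup => _ [u /= uf <-].
by exists u => //= x; exact: le_trans (fg x).
Qed.

Section no_return.
Context (R : realType) (S : pointedType) (S_countable : countable [set: S]).
Context (Xi : completeMetricType R) (h : S * Xi -> S).
Hypothesis h_measurable : measurable_fun setT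
  (h : discreteType S * borelType Xi -> discreteType S).
Context (xs : S).

Local Notation coord := (@coord Xi).
Implicit Types x : path Xi.

Definition no_return n : set (path Xi) := [set x | forall j, (0 < j <= n)%N ->
  (iter j (f_plus h coord x) (0, xs)).2 <> xs].

Lemma measurable_no_return n : measurable (no_return n).
Proof.
apply: (salg_all (measurable_salg _)) => // j.
apply: (salg_imp (measurable_salg _));
  first exact: (salg_cst (measurable_salg _)).
apply: (salgC (measurable_salg _)).
by apply: measurable_iter_f_plus => // t; exact: measurable_coord.
Qed.

(** With tau the return time, [no_return n] is the event tau > n, and the sum of these indicators
    over n >= 0 counts up to tau: a return at time s kills every term with n >= s. *)
Lemma sum_no_return_le_return_time x :
  (\sum_(n <oo) (\1_(no_return n) x)%:E <= return_time h coord xs x)%E.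
Proof.
apply: le_ereal_inf_tmp => _ [s [s0 xss] <-].
apply: lime_le; first by apply: is_cvg_nneseries => n _ _; rewrite lee_fin.
apply: nearW => N; rewrite sumEFin lee_fin.
have le n : (\1_(no_return n) x : R) <= (n < s)%N%:R.
  rewrite indicE ler_nat; case: ltnP => sn; first by case: (_ \in _).
  suff -> : x \in no_return n = false by [].
  apply/negP; rewrite inE => /(_ s); rewrite s0 sn => /(_ isT); apply.
  by rewrite -[RHS]xss /doeblin_state subr0.
rewrite (le_trans (ler_sum _ (fun n _ => le n)))// -natr_sum ler_nat.
suff -> : (\sum_(0 <= n < N) (n < s))%N = minn N s by exact: geq_minr.
elim: N => [|N IH]; first by rewrite big_geq// min0n.
by rewrite big_nat_recr//= IH; case: ltnP => /= ?; lia.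
Qed.

(* A state of the bridge at time 0 is reached from the last visit to [xs]
   before time 0 on a path leading to it, and that path avoids [xs]. *)
Lemma bridge_states_no_return x y : bridge_states h coord xs x 0 y ->
  exists n : nat, (iter n (f_plus h coord x) (- n%:Z, xs)).2 = y /\
    no_return n (shiftn (- n%:Z) x).
Proof.
move=> /bridge_vertP /= ex.
have {}ex : exists n : nat, `[< (iter n (f_plus h coord x) (0 - n%:Z, xs)).2 = y
  >].
  by case: ex => n ?; exists n; apply/asboolP.
(* The last visit is encoded by the least delay: a visit to [xs] after j more steps would give the
   smaller delay n - j. *)
case: (ex_minnP ex) => n /asboolP ny nmin; exists n; rewrite -[- _]add0r;
  split=> //.
move=> j /andP[j0 jn]; rewrite iter_f_plus_shift !add0r => e.
suff : (n <= n - j)%N by rewrite leqNgt ltn_subrL j0 (leq_trans j0 jn).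
apply: nmin; apply/asboolP; rewrite -ny -[in RHS](subnK jn) iterD (subnK jn);
  congr (iter _ _ _).2.
rewrite [RHS]surjective_pairing !sub0r e iter_f_plus_time; congr (_, _).
by rewrite -subzn// opprB addrC.
Qed.

(** A delay determines the state reached at time 0, so choosing one delay for each state is
    injective, and counting states becomes counting delays. *)
Lemma bridge_card_le x :
  (\esum_(y in bridge_states h coord xs x 0) 1 <=
   \sum_(n <oo) (\1_(no_return n) (shiftn (- n%:Z) x))%:E :> \bar R)%E.
Proof.
have /choice[g gP] : forall y, exists n, bridge_states h coord xs x 0 y ->
    (iter n (f_plus h coord x) (- n%:Z, xs)).2 = y /\
    no_return n (shiftn (- n%:Z) x).
  move=> y; have [/bridge_states_no_return[n nP]|] :=
    pselect (bridge_states h coord xs x 0 y); first by exists n.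
  by exists 0%N.
have ginj : set_inj (bridge_states h coord xs x 0) g.
  move=> y z; rewrite !inE => /gP[yn _] /gP[zn _] yz.
  by rewrite -yn -zn yz.
rewrite nneseries_esumT; last by move=> n; rewrite lee_fin.
rewrite -(esum_image _ _ (fun=> 1%E) ginj) esum_mkcond.
apply: le_esum => n _; case: ifPn => [|_]; last by rewrite lee_fin.
by rewrite inE => -[y /gP[_ nr] <-]; rewrite indicE mem_set.
Qed.

Context (Q : probability (path Xi) R).
Hypothesis Q_shift : forall k (A : set (path Xi)),
  measurable A -> Q (shiftn k @^-1` A) = Q A.

Lemma expected_bridge_card_lty :
  (\int[Q]_x (\sum_(n <oo) (\1_(no_return n) x)%:E) < +oo)%E ->
  (\int[Q]_x (\esum_(y in bridge_states h coord xs x 0) 1) < +oo)%E.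
Proof.
apply: le_lt_trans.
have mi n : measurable_fun setT (fun x => (\1_(no_return n) x : R)%:E).
  by apply/measurable_EFinP; apply: measurable_indic;
    exact: measurable_no_return.
apply: (@le_trans _ _
    (\int[Q]_x \sum_(n <oo) (\1_(no_return n) (shiftn (- n%:Z) x))%:E)%E).
  apply: le_integral_nonmeasurable => x; last exact: bridge_card_le.
  by apply: esum_ge0.
rewrite !integral_nneseries//; last first.
  by move=> n; apply: (measurableT_comp (mi n)); exact: measurable_shiftn.
apply: lee_nneseries => [n _ _|n _]; first exact: integral_ge0.
(* By stationarity the term of delay n contributes the probability of [no_return n]. *)
rewrite (ge0_integral_preserving (@measurable_shiftn _ _) _ (mi n))//.
by move=> A mA; exact: Q_shift.
Qed.

End no_return.

Lemma ae_forallz d (T : measurableType d) (R : realType)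
    (mu : {measure set T -> \bar R}) (A : int -> T -> Prop) :
  (forall t, {ae mu, forall x, A t x}) -> {ae mu, forall x, forall t, A t x}.
Proof.
move=> h.
have pos : {ae mu, forall x, forall n : nat, A n%:Z x} by apply/ae_foralln => n.
have neg : {ae mu, forall x, forall n : nat, A (Negz n) x} by apply/ae_foralln
  => n.
by apply: filterS2 pos neg => x pos neg [].
Qed.

(** * Ergodic averages over windows *)

Section ergodic_averages.
Context (R : realType) (Xi : ptopologicalType) (Q : probability (path Xi) R).
Hypothesis Q_shift : forall k (A : set (path Xi)),
  measurable A -> Q (shiftn k @^-1` A) = Q A.
Hypothesis Q_ergodic : forall A : set (path Xi),
  measurable A -> shiftn 1 @^-1` A = A -> Q A = 0%E \/ Q A = 1%E.

Lemma ae_shiftn k (A : path Xi -> Prop) : {ae Q, forall x, A x} ->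
  {ae Q, forall x, A (shiftn k x)}.
Proof.
move=> [N [mN N0 AN]]; exists (shiftn k @^-1` N); split.
- by rewrite -[X in measurable X]setTI; exact: measurable_shiftn.
- by rewrite Q_shift.
- by move=> x /= /AN.
Qed.

Lemma iter_shiftn k n (x : path Xi) : iter n (shiftn k) x = shiftn (k * n%:Z) x.
Proof.
elim: n => [|n IH]; first by rewrite mulr0 shiftn0.
by rewrite iterS IH shiftnD -addn1 PoszD mulrDr mulr1 addrC.
Qed.

Lemma birkhoff_shiftn (F : path Xi -> R) (m : R) (k : int) :
  k = 1 \/ k = -1 ->
  Q.-integrable setT (EFin \o F) -> (\int[Q]_x (F x)%:E = m%:E)%E ->
  {ae Q, forall x, forall e, 0 < e -> exists C, forall n,
    `|birkhoff_sum (shiftn k) F n x - n%:R * m| <= n%:R * e + C}.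
Proof.
move=> k1 intF Fm; apply: birkhoff => //.
- exact: measurable_shiftn.
- by move=> A mA; exact: Q_shift.
(* A set fixed by the backward shift is also fixed by the forward one, so both shifts are
   ergodic. *)
- move=> A mA kA; apply: Q_ergodic => //; case: k1 kA => -> // kA.
  rewrite -[in LHS]kA; apply/seteqP; split => x;
    by rewrite /preimage /mkset shiftnD addNr shiftn0.
Qed.

(** The times before [t0] are run through backwards. They start at t0 - 1, not at t0, whence the
    extra [shiftn (-1)] inside the first Birkhoff sum. *)
Lemma window_sum_split (F : path Xi -> R) x (u t0 : int) (k : nat) :
  u <= t0 -> t0 <= u + k%:Z -> exists p q, (p + q)%N = k /\
  \sum_(i < k) F (shiftn (u + i%:Z) x) =
  birkhoff_sum (shiftn (-1)) (F \o shiftn (-1)) p (shiftn t0 x) +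
  birkhoff_sum (shiftn 1) F q (shiftn t0 x).
Proof.
move=> ut tk; exists `|t0 - u|%N, (k - `|t0 - u|)%N.
have e : (`|t0 - u| + (k - `|t0 - u|))%N = k by lia.
split => //; rewrite -[in LHS]e big_split_ord /=; congr (_ + _).
  rewrite (reindex_inj rev_ord_inj) /birkhoff_sum; apply: eq_bigr => i _ /=.
  rewrite iter_shiftn !shiftnD; congr (F (shiftn _ x)).
  by have := ltn_ord i; lia.
apply: eq_bigr => i _ /=; rewrite iter_shiftn !shiftnD.
congr (F (shiftn _ x)); lia.
Qed.

(** The windows are quantified inside the almost sure statement: a countable intersection over base
    points yields one null set, so trimmed windows can be used later on the same event. *)
Lemma ergodic_window_average (F : path Xi -> R) (m : R) :
  Q.-integrable setT (EFin \o F) -> (\int[Q]_x (F x)%:E = m%:E)%E ->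
  {ae Q, forall x, forall (u : nat -> int) (k : nat -> nat) (t0 : int),
    (\forall n \near \oo, u n <= t0 <= u n + (k n)%:Z) ->
    (forall K, \forall n \near \oo, (K <= k n)%N) ->
    (\sum_(i < k n) F (shiftn (u n + i%:Z) x)) / (k n)%:R @[n --> \oo] --> m}.
Proof.
move=> intF Fm.
have Qm1 : forall A : set (path Xi), measurable A ->
  Q (shiftn (-1) @^-1` A) = Q A.
  by move=> A mA; exact: Q_shift.
have intF' : Q.-integrable setT (EFin \o (F \o shiftn (-1))).
  exact: (integrable_preserving (@measurable_shiftn _ _) Qm1 intF).
have Fm' : (\int[Q]_x ((F \o shiftn (-1)) x)%:E = m%:E)%E.
  by rewrite -Fm; exact: (integral_preserving (@measurable_shiftn _ _) Qm1
    intF).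
have fwd := ae_forallz (fun t => ae_shiftn t
  (birkhoff_shiftn (or_introl erefl) intF Fm)).
have bwd := ae_forallz (fun t => ae_shiftn t
  (birkhoff_shiftn (or_intror erefl) intF' Fm')).
apply: filterS2 fwd bwd => x fwd bwd u k t0 ukt k_oo.
apply/cvgrPdist_le => /= e e0.
have e20 : 0 < e / 2 by rewrite divr_gt0.
have [C1 HC1] := fwd t0 _ e20; have [C2 HC2] := bwd t0 _ e20.
(* For a window of length at least [K] the constants C1 + C2 cost at most e/2 per unit of length;
   the linear errors of the two pieces cost the other e/2. *)
pose K := (Num.bound (`|C1 + C2| / (e / 2))).+1.
near=> n.
have Kn : (K <= k n)%N by near: n; exact: k_oo.
have k0 : 0 < (k n)%:R :> R by rewrite ltr0n (leq_trans _ Kn).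
have /andP[ut tk] : u n <= t0 <= u n + (k n)%:Z by near: n.
have [p [q [pq ->]]] := window_sum_split F x ut tk.
rewrite -(ler_pM2r k0) -[X in _ * X <= _](ger0_norm (ltW k0)) -normrM mulrBl.
rewrite divfK ?gt_eqF// distrC.
have pqk : (k n)%:R = p%:R + q%:R :> R by rewrite -pq natrD.
have := HC1 q; have := HC2 p.
have C0 : C1 + C2 <= (k n)%:R * (e / 2).
  rewrite -ler_pdivrMr// (le_trans (ler_norm _))// normrM normfV.
  rewrite [X in _ / X]gtr0_norm// (le_trans (ltW (archi_boundP _)))//.
    by rewrite divr_ge0// ltW.
  by rewrite ler_nat (leq_trans _ Kn)// leqnSn.
rewrite !ler_norml pqk in C0 *; lra.
Unshelve. all: by end_near.
Qed.

End ergodic_averages.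

(** * Sums over time slices of the bridge *)

Section esum_finite.
Context (R : realType) (T : choiceType).
Local Open Scope ereal_scope.

Lemma esum_lty_finite_set (B : set T) :
  \esum_(y in B) (1 : \bar R) < +oo -> finite_set B.
Proof.
apply: contraPP => infB; apply/negP; rewrite -leNgt leye_eq;
  apply/eqP/eqyP => r r0.
have [X XB Xr] := infinite_set_fset (Num.bound r) infB.
apply: (@le_trans _ _ (\sum_(y <- X) 1)).
  rewrite sumEFin lee_fin big_const_seq count_predT iter_addr_0.
  by rewrite (le_trans (ltW (archi_boundP (ltW r0))))// ler_nat.
apply: esum_ge; exists [set` X]; first by split.
rewrite le_eqVlt; apply/orP; left; apply/eqP.
exact: (@fsbig_seq _ _ _ _ X (fun=> 1) (fset_uniq X)).
Qed.

Lemma esum_finite_EFin (B : set T) (a : T -> R) : finite_set B ->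
  (forall y, B y -> 0 <= a y)%R ->
  \esum_(y in B) (a y)%:E = (\sum_(y \in B) a y)%:E.
Proof.
move=> fB a0; rewrite esum_fset//; last by move=> y By;
  rewrite lee_fin a0// -inE.
by rewrite fsumEFin.
Qed.

Lemma le_esumZ (B : set T) (a : T -> \bar R) (k : R) : (0 <= k)%R ->
  (forall y, 0 <= a y) ->
  \esum_(y in B) (k%:E * a y) <= k%:E * \esum_(y in B) a y.
Proof.
move=> k0 a0; apply: ge_ereal_sup => _ [X [fX XB] <-].
rewrite -ge0_mule_fsumr//; apply: lee_wpmul2l; first by rewrite lee_fin.
by apply: esum_ge; exists X.
Qed.

End esum_finite.

Section bridge_sum.
Context (R : realType) (S : pointedType) (S_countable : countable [set: S]).
Context (Xi : completeMetricType R) (h : S * Xi -> S).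
Hypothesis h_measurable : measurable_fun setT
  (h : discreteType S * borelType Xi -> discreteType S).
Context (xs : S).

Local Notation coord := (@coord Xi).
Local Notation B_ := (bridge_states h coord xs).

(** Extended-real valued, because B_0 is finite only almost surely; its image under [fine] is the
    real observable averaged along the shift. *)
Definition bridge_sum (a : S -> path Xi -> R) (x : path Xi) : \bar R :=
  (\esum_(y in B_ x 0) (a y x)%:E)%E.

Let bridge_sumE a x : bridge_sum a x =
  (\esum_(y in [set: S]) (\1_[set x | B_ x 0 y] x * a y x)%:E)%E.
Proof.
rewrite /bridge_sum esum_mkcond; apply: eq_esum => y _; rewrite indicE.
rewrite (_ : (x \in _) = (y \in B_ x 0)); first by case: ifP => _;
  rewrite ?mul1r ?mul0r.
by apply/idP/idP; rewrite !inE.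
Qed.

Lemma measurable_bridge_sum (a : S -> path Xi -> R) :
  (forall y, measurable_fun setT (a y)) -> (forall y x, 0 <= a y x) ->
  measurable_fun setT (bridge_sum a).
Proof.
move=> ma a0; rewrite (_ : bridge_sum a = fun x => (\esum_(y in [set: S])
    (\1_[set x | B_ x 0 y] x * a y x)%:E)%E); last first.
  by apply/funext => x; exact: bridge_sumE.
apply: measurable_countable_esum => // [y|y x];
  last by rewrite lee_fin mulr_ge0.
apply/measurable_EFinP; apply: measurable_funM => //.
apply: measurable_indic; apply: measurable_bridge_vert => // t.
exact: measurable_coord.
Qed.

Lemma bridge_sum_ge0 (a : S -> path Xi -> R) x : (forall y x, 0 <= a y x) ->
  (0 <= bridge_sum a x)%E.
Proof. by move=> a0; apply: esum_ge0 => y _; rewrite lee_fin. Qed.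

Lemma bridge_sum_le (a : S -> path Xi -> R) K x :
  (forall y x, 0 <= a y x <= K) ->
  (bridge_sum a x <= K%:E * bridge_sum (fun _ _ => 1%R) x)%E.
Proof.
move=> aK; have K0 : 0 <= K.
  by have /andP[? ?] := aK point x; exact: (le_trans _ (_ : a point x <= K)).
apply: le_trans (le_esumZ _ K0 _) => //.
apply: le_esum => y _; rewrite mule1 lee_fin.
by have /andP[] := aK y x.
Qed.

Lemma bridge_sum_finite (a : S -> path Xi -> R) x : finite_set (B_ x 0) ->
  (forall y x, 0 <= a y x) ->
  fine (bridge_sum a x) = \sum_(y \in B_ x 0) a y x.
Proof. by move=> fB a0; rewrite /bridge_sum esum_finite_EFin. Qed.

Context (Q : probability (path Xi) R).
Hypothesis Q_shift : forall k (A : set (path Xi)),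
  measurable A -> Q (shiftn k @^-1` A) = Q A.
Hypothesis expected_card_lty :
  (\int[Q]_x bridge_sum (fun _ _ => 1%R) x < +oo)%E.

Lemma ae_bridge_states_finite :
  {ae Q, forall x, forall t, finite_set (B_ x t)}.
Proof.
have ae0 : {ae Q, forall x, finite_set (B_ x 0)}.
  have int1 : Q.-integrable setT (bridge_sum (fun _ _ => 1%R)).
    apply/integrableP; split; first exact: measurable_bridge_sum.
    under eq_integral do rewrite gee0_abs ?bridge_sum_ge0//.
    exact: expected_card_lty.
  apply: filterS (integrable_ae measurableT int1) => x /(_ I) fx.
  by apply: (@esum_lty_finite_set R); rewrite ltey_eq fx.
apply: ae_forallz => t; have := ae_shiftn Q_shift t ae0.
by apply: filterS => x; rewrite bridge_states_shift add0r.
Qed.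

Section integral.
Context (a : S -> path Xi -> R) (K : R).
Hypothesis ma : forall y, measurable_fun setT (a y).
Hypothesis aK : forall y x, 0 <= a y x <= K.

Let a0 y x : 0 <= a y x. Proof. by have /andP[] := aK y x. Qed.

Lemma integral_bridge_sum_lty : (\int[Q]_x bridge_sum a x < +oo)%E.
Proof.
have K0 : 0 <= K by have /andP[? ?] := aK point point;
  exact: (le_trans _ (_ : a point point <= K)).
apply: (@le_lt_trans _ _ (\int[Q]_x (K%:E * bridge_sum (fun _ _ => 1%R) x))%E).
  apply: le_integral_nonmeasurable => x; first exact: bridge_sum_ge0.
  exact: bridge_sum_le.
rewrite ge0_integralZl_EFin//.
- by rewrite lte_mul_pinfty.
- by move=> x _; exact: bridge_sum_ge0.
- exact: measurable_bridge_sum.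
Qed.

Lemma integrable_bridge_sum : Q.-integrable setT
  (EFin \o (fine \o bridge_sum a)).
Proof.
have int : Q.-integrable setT (bridge_sum a).
  apply/integrableP; split; first exact: measurable_bridge_sum.
  under eq_integral do rewrite gee0_abs ?bridge_sum_ge0//.
  exact: integral_bridge_sum_lty.
apply: le_integrable int => //.
  apply/measurable_EFinP; apply: measurableT_comp => //.
  exact: measurable_bridge_sum.
move=> x _ /=; have := bridge_sum_ge0 x a0; case: (bridge_sum a x) => //= _.
by rewrite normr0 leey.
Qed.

Lemma integral_fine_bridge_sum :
  (\int[Q]_x (fine (bridge_sum a x))%:E = \int[Q]_x bridge_sum a x)%E.
Proof.
apply: ge0_ae_eq_integral => //.
- by have /integrableP[] := integrable_bridge_sum.
- exact: measurable_bridge_sum.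
- by move=> x _; rewrite lee_fin fine_ge0// bridge_sum_ge0.
- by move=> x _; exact: bridge_sum_ge0.
apply: filterS ae_bridge_states_finite => x /(_ 0) fB _.
by rewrite bridge_sum_finite// /bridge_sum esum_finite_EFin.
Qed.

Lemma integral_fine_bridge_sumE :
  (\int[Q]_x (fine (bridge_sum a x))%:E =
    (fine (\int[Q]_x bridge_sum a x))%:E)%E.
Proof.
rewrite integral_fine_bridge_sum fineK// ge0_fin_numE
  ?integral_bridge_sum_lty//.
by apply: integral_ge0 => x _; exact: bridge_sum_ge0.
Qed.

End integral.
End bridge_sum.

Section window_sums.
Context (R : realType) (S : pointedType) (Xi : completeMetricType R).
Context (h : S * Xi -> S) (xs : S).
Local Notation coord := (@coord Xi).
Local Notation B_ := (bridge_states h coord xs).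

Definition interval_set (u : int) (k : nat) : set int :=
  [set t | u <= t < u + k%:Z].

Variables (x : path Xi) (u : int).
Hypothesis fin : forall t, finite_set (B_ x t).

Lemma bridge_windowS k :
  bridge_window h coord xs (interval_set u k.+1) x =
  bridge_window h coord xs (interval_set u k) x `|`
  (pair (u + k%:Z) @` B_ x (u + k%:Z)).
Proof.
apply/seteqP; split => [[t y] [/= yB tk]|[t y] [[/= yB tk]|[z zB [<- <-]]]].
- have [tuk|tuk] := eqVneq t (u + k%:Z).
    by right; exists y; rewrite -tuk.
  by left; split => //; move: tk; rewrite /interval_set /=; lia.
- by split => //; move: tk; rewrite /interval_set /=; lia.
- by split => //=; rewrite /interval_set /=; lia.
Qed.

Lemma bridge_window_finite k :
  finite_set (bridge_window h coord xs (interval_set u k) x).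
Proof.
elim: k => [|k IH].
  rewrite (_ : bridge_window _ _ _ _ _ = set0)//.
  by apply/seteqP; split => // -[t y] [_]; rewrite /interval_set /=; lia.
by rewrite bridge_windowS finite_setU; split => //; exact: finite_image.
Qed.

Lemma bridge_window_sum (b : int * S -> R) k :
  \sum_(v \in bridge_window h coord xs (interval_set u k) x) b v =
  \sum_(i < k) \sum_(y \in B_ x (u + i%:Z)) b (u + i%:Z, y).
Proof.
elim: k => [|k IH].
  rewrite big_ord0 (_ : bridge_window _ _ _ _ _ = set0) ?fsbig_set0//.
  by apply/seteqP; split => // -[t y] [_]; rewrite /interval_set /=; lia.
rewrite bridge_windowS fsbigU//=.
- rewrite big_ord_recr /= IH; congr (_ + _).
  rewrite (reindex_fsbig (pair (u + k%:Z)) (B_ x (u + k%:Z)))//.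
  by apply: inj_bij => y z _ _ [].
- exact: bridge_window_finite.
- exact: finite_image.
- by move=> [t y] [[/= _ tk] [z _ [tE _]]]; move: tk; rewrite /interval_set /=;
    lia.
Qed.

End window_sums.

(** * Cutting the bridge to a finite window *)

Section reach_induced.
Context (M V : Type) (G : mgraph M V) (A : set V) (o : V).

Lemma reach_induced_sub n : reach (Defs.induced G A) o n `<=` reach G o n.
Proof.
elim: n => [|n IH] u /=; first by case=> -> [].
by case=> [/IH|[v /IH ov [vu _ _]]]; [left|right; exists v].
Qed.

Lemma reach_induced N n : reach G o N `<=` A -> (n <= N)%N ->
  reach (Defs.induced G A) o n = reach G o n.
Proof.
move=> NA; elim: n => [|n IH] nN.
  apply/seteqP; split => u; first exact: reach_induced_sub.
  by move=> ou; have uA := NA _ (reach_le nN ou); case: ou => ou uG; do !split.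
apply/seteqP; split => u; first exact: reach_induced_sub.
move=> ou; have uA := NA _ (reach_le nN ou); case: ou => /= [ou|[v ov vu]].
  by left; rewrite IH// ltnW.
right; exists v; first by rewrite IH// ltnW.
by split => //; apply: NA; exact: (reach_le (ltnW nN)).
Qed.

Lemma ball_induced N : reach G o N `<=` A ->
  ball_graph (Defs.induced G A) o N = ball_graph G o N.
Proof.
move=> NA; apply: mgraph_eq => //=; rewrite (reach_induced NA (leqnn N)).
  by apply/seteqP; split => u /= [] => [[uG _] uN|uG uN]; do !split => //;
    exact: NA.
by move=> u v; split=> -[] => [[]//|uv uN vN]; do !split => //; exact: NA.
Qed.

End reach_induced.

(** A common weakening of [local_functional] and of continuity: the radius may depend on the network
    and on the tolerance. *)
Definition asymptotically_local (R : realType) (M : completeMetricType R)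
    (g : Gstar M -> R) :=
  forall C e, 0 < e -> exists N, forall D, balls_similar eq N C D ->
    `|g C - g D| <= e.

Section cesaro_limits.
Context (R : realType).
Implicit Types (a b : nat -> R).

Lemma cvg_ratio a b (k : nat -> R) (x y : R) : y != 0 ->
  (\forall n \near \oo, k n != 0) ->
  a n / k n @[n --> \oo] --> x -> b n / k n @[n --> \oo] --> y ->
  a n / b n @[n --> \oo] --> x / y.
Proof.
move=> y0 k0 ax bY.
have h : (a n / k n) * (b n / k n)^-1 @[n --> \oo] --> x * y^-1.
  by apply: cvgM => //; exact: cvgV.
apply: cvg_trans h; apply: near_eq_cvg; apply: filterS k0 => n kn0.
by rewrite invf_div mulrA divfK.
Qed.

Lemma cvg_inv_pinfty (k : nat -> nat) (c : R) :
  (forall K, \forall n \near \oo, (K <= k n)%N) ->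
  c / (k n)%:R @[n --> \oo] --> (0 : R).
Proof.
move=> k_oo; apply/cvgrPdist_le => /= e e0.
apply: filterS (k_oo (Num.bound (`|c| / e)).+1) => n Kn.
have k0 : 0 < (k n)%:R :> R by rewrite ltr0n (leq_trans _ Kn).
rewrite sub0r normrN normrM normfV (gtr0_norm k0) ler_pdivrMr//.
rewrite mulrC -ler_pdivrMr// (le_trans (ltW (archi_boundP _)))//.
  by rewrite divr_ge0// ltW.
by rewrite ler_nat (leq_trans _ Kn)// leqnSn.
Qed.

Lemma cvg_trimmed_average (k : nat -> nat) p (s : nat -> R) (m : R) :
  (forall K, \forall n \near \oo, (K <= k n)%N) ->
  s n / (k n - p)%:R @[n --> \oo] --> m -> s n / (k n)%:R @[n --> \oo] --> m.
Proof.
move=> k_oo sm.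
have h : (s n / (k n - p)%:R) * (1 - p%:R / (k n)%:R) @[n --> \oo] -->
  m * (1 - 0).
  apply: cvgM => //; apply: cvgB; first exact: cvg_cst.
  exact: cvg_inv_pinfty.
rewrite subr0 mulr1 in h; apply: cvg_trans h; apply: near_eq_cvg.
apply: filterS (k_oo p.+1) => n pk.
have k0 : (k n)%:R != 0 :> R by rewrite pnatr_eq0; lia.
have kp0 : (k n - p)%:R != 0 :> R by rewrite pnatr_eq0; lia.
have e : (k n)%:R = (k n - p)%:R + p%:R :> R by rewrite -natrD subnK// ltnW.
move: k0; rewrite e => k0; field; by rewrite k0 kp0.
Qed.

(** The three error terms are a tolerance 1/(j + 1) per vertex, the density of sensitive vertices
    and the share of the boundary. The parameters are fixed in this order: j for the tolerance, then
    p for the density, and finally n for the boundary. *)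
Lemma cvg_approximation (a s v : nat -> R) (w : nat -> nat -> R)
    (d : nat -> nat -> nat -> R) (K x y : R) (z : nat -> nat -> R) :
  0 <= K ->
  (forall j p, \forall n \near \oo,
    `|a n - s n| <= j.+1%:R^-1 * v n + K * d j p n + K * (v n - w p n)) ->
  s n @[n --> \oo] --> x -> v n @[n --> \oo] --> y ->
  (forall p, w p n @[n --> \oo] --> y) ->
  (forall j p, d j p n @[n --> \oo] --> z j p) ->
  (forall j, z j p @[p --> \oo] --> (0 : R)) ->
  a n @[n --> \oo] --> x.
Proof.
move=> K0 le sx vy wy dz z0; apply/cvgrPdist_le => /= e e0.
have e40 : 0 < e / 4 by rewrite divr_gt0.
have [j jy] : exists j : nat, j.+1%:R^-1 * y < e / 4.
  exists (Num.bound (`|y| / (e / 4))).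
  rewrite mulrC ltr_pdivrMr// mulrC -ltr_pdivrMr//.
  rewrite (le_lt_trans (_ : _ <= `|y| / (e / 4)))//.
    by rewrite ler_wpM2r ?ler_norm// invr_ge0 ltW.
  rewrite (lt_trans (archi_boundP _))// ?ltr_nat// divr_ge0//; exact: ltW.
have [p pz] : exists p, K * z j p < e / 4.
  have : K * z j p @[p --> \oo] --> K * 0 by apply: cvgM => //; exact: cvg_cst.
  rewrite mulr0 => /cvgrPdist_lt/(_ _ e40)[p _ /(_ p (leqnn p))] /=.
  by rewrite sub0r normrN => /(le_lt_trans (ler_norm _)); exists p.
have lim : j.+1%:R^-1 * v n + K * d j p n + K * (v n - w p n) @[n --> \oo] -->
    j.+1%:R^-1 * y + K * z j p + K * (y - y).
  apply: cvgD; [apply: cvgD|]; apply: cvgM => //; try exact: cvg_cst.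
  exact: cvgB.
have small : j.+1%:R^-1 * y + K * z j p + K * (y - y) < e / 2.
  rewrite subrr mulr0 addr0 (_ : e / 2 = e / 4 + e / 4) ?ltrD//; lra.
have near_small : \forall n \near \oo,
    j.+1%:R^-1 * v n + K * d j p n + K * (v n - w p n) < e / 2.
  exact: (cvgr_lt _ lim).
have /cvgrPdist_le/(_ (e / 2)) near_s := sx.
near=> n.
rewrite (_ : x - a n = (x - s n) + (s n - a n)); last by rewrite addrA subrK.
rewrite (le_trans (ler_normD _ _))// [leRHS]splitr lerD//.
  by near: n; apply: near_s; rewrite divr_gt0.
rewrite distrC (@le_trans _ _ (j.+1%:R^-1 * v n + K * d j p n + K *
  (v n - w p n)))//.
  by near: n; exact: le.
by apply/ltW; near: n.
Unshelve. all: by end_near.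
Qed.

End cesaro_limits.

Section windows.
Context (R : realType) (S : pointedType) (S_countable : countable [set: S]).
Context (Xi : completeMetricType R) (h : S * Xi -> S) (xs : S).
Context (M : completeMetricType R) (iota : S * Xi -> M) (kappa : bool -> M).

Local Notation coord := (@coord Xi).
Local Notation B_ := (bridge_states h coord xs).
Local Notation bar := (bar_bridge h coord xs iota kappa).
Local Notation bar_window := (bar_bridge_window h coord xs iota kappa).
Implicit Types x : path Xi.

(** Every edge, spine included, joins consecutive times. Hence balls lie in finite slabs of time,
    which gives both their finiteness and their insensitivity to distant cuts. *)
Lemma reach_bar_time x v n u : reach (bar x) v n u ->
  v.1 - n%:Z <= u.1 <= v.1 + n%:Z.
Proof.
elim: n u => [|n IH] u /=; first by move=> [-> _]; lia.
case=> [/IH|[r /IH rn]]; first lia.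
by case=> /spined_edge_time; lia.
Qed.

Lemma finite_reach_bar x v n : (forall t, finite_set (B_ x t)) ->
  finite_set (reach (bar x) v n).
Proof.
move=> fin; apply: sub_finite_set
  (bridge_window_finite (v.1 - n%:Z) fin (n + n).+1).
move=> u vu; split; first exact: reach_vert vu.
by have := reach_bar_time vu; rewrite /interval_set /=; lia.
Qed.

Lemma finite_reach_bar_window x I v n : (forall t, finite_set (B_ x t)) ->
  finite_set (reach (bar_window I x) v n).
Proof.
move=> fin; apply: sub_finite_set (finite_reach_bar v n fin).
exact: reach_induced_sub.
Qed.

Lemma balls_similar_window x (I : set int) v N :
  (forall t, finite_set (B_ x t)) -> bridge_vert h coord xs x v ->
  (forall t, v.1 - N%:Z <= t <= v.1 + N%:Z -> I t) ->
  balls_similar eq N (net_class (bar x) v) (net_class (bar_window I x) v).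
Proof.
move=> fin vB NI; have cV := countable_prodT (countableP [set: int])
  S_countable.
apply: balls_similar_net_class => //.
- by move=> n; exact: finite_reach_bar.
- by split => //; split => //; apply: NI; lia.
- by move=> n; exact: finite_reach_bar_window.
rewrite /bar_bridge_window ball_induced; last first.
  move=> u vu; split; first exact: reach_vert vu.
  exact: NI (reach_bar_time vu).
exists id; split => //; split => //; first by move=> u uB; exists u.
Qed.

Context (g : Gstar M -> R) (K : R).
Hypothesis gK : forall C, 0 <= g C <= K.

Let g0 C : 0 <= g C. Proof. by case/andP: (gK C). Qed.
Let K0 : 0 <= K. Proof. by case/andP: (gK point) => ? ?;
  exact: (le_trans _ (_ : g point <= K)). Qed.

Let g_diff C D : `|g C - g D| <= K.
Proof. have := gK C; have := gK D; rewrite ler_norml; lra. Qed.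

Definition root_value (y : S) x : R := g (net_class (bar x) (0, y)).

(** The window is [-l, r], seen from a root at time 0 with [l] and [r] the distances to the two
    ends. *)
Definition cut_value (l r : nat) (y : S) x : R :=
  g (net_class (bar_window (interval_set (- l%:Z) (l + r).+1) x) (0, y)).

(* The density of sensitive vertices vanishes as [p] grows, so that a continuous
   [g], which depends on the whole graph, can be treated like a local one. *)
Definition sensitive (p j : nat) (y : S) : set (path Xi) :=
  [set x | exists lr : nat * nat, ((p <= lr.1)%N && (p <= lr.2)%N) /\
     j.+1%:R^-1 < `|cut_value lr.1 lr.2 y x - root_value y x|].

Local Notation card_weight := (fun (_ : S) (_ : path Xi) => 1%R : R).
Local Notation sensitive_weight p j :=
  (fun y => \1_(sensitive p j y) : path Xi -> R).

Local Notation F a x := (fine (bridge_sum h xs a x)).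

Lemma sensitive_vanish x j : asymptotically_local g ->
  (forall t, finite_set (B_ x t)) ->
  \forall p \near \oo, F (sensitive_weight p j) x = 0.
Proof.
move=> gl fin.
have /choice[N HN] : forall y, exists N, forall p, (N <= p)%N ->
    B_ x 0 y -> ~ sensitive p j y x.
  move=> y; have [|N HN] := gl (net_class (bar x) (0, y)) j.+1%:R^-1.
    by rewrite invr_gt0.
  exists N => p Np yB [[l r] [/andP[/= pl pr]]]; rewrite ltNge => /negP; apply.
  rewrite distrC; apply: HN; apply: balls_similar_window => //.
  by move=> t /=; rewrite /interval_set /=; lia.
have /finite_fsetP[X XB] := fin 0.
exists (\max_(y <- X) N y)%N => // p /= Np.
rewrite bridge_sum_finite// fsbig1// => y yB.
rewrite indicE memNset//; apply: HN => //; apply: leq_trans Np.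
apply: leq_bigmax_seq => //; by move: yB; rewrite XB.
Qed.

Lemma bridge_sum_shift (a : S -> path Xi -> R) x t :
  (forall t, finite_set (B_ x t)) -> (forall y x, 0 <= a y x) ->
  F a (shiftn t x) = \sum_(y \in B_ x t) a y (shiftn t x).
Proof.
by move=> fin a0; rewrite bridge_sum_finite// bridge_states_shift add0r.
Qed.

Lemma bridge_sum_shift_seq (a : S -> path Xi -> R) x t :
  (forall t, finite_set (B_ x t)) -> (forall y x, 0 <= a y x) ->
  F a (shiftn t x) = \sum_(y <- fset_set (B_ x t)) a y (shiftn t x).
Proof. by move=> fin a0; rewrite bridge_sum_shift// fsbig_finite. Qed.

(** A vertex within p of the boundary, or a sensitive one, costs at most K; every other one costs at
    most 1/(j + 1). The boundary vertices are counted as all vertices minus those of the window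
    trimmed by p at each end. *)
Lemma window_error (x : path Xi) (u : int) (k p j : nat) :
  (forall t, finite_set (B_ x t)) -> (p + p <= k)%N ->
  `|\sum_(v \in bridge_window h coord xs (interval_set u k) x)
       g (net_class (bar_window (interval_set u k) x) v) -
    \sum_(i < k) F root_value (shiftn (u + i%:Z) x)| <=
  j.+1%:R^-1 * (\sum_(i < k) F card_weight (shiftn (u + i%:Z) x)) +
  K * (\sum_(i < k) F (sensitive_weight p j) (shiftn (u + i%:Z) x)) +
  K * (\sum_(i < k) F card_weight (shiftn (u + i%:Z) x) -
       \sum_(i < k - (p + p)) F card_weight (shiftn (u + p%:Z + i%:Z) x)).
Proof.
move=> fin pk; set I := interval_set u k; rewrite bridge_window_sum//.
pose outer i : bool := ~~ ((p <= i)%N && (i < k - p)%N).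
have outer_sum : \sum_(i < k) (outer i)%:R * F card_weight (shiftn (u + i%:Z) x)
  =
    \sum_(i < k) F card_weight (shiftn (u + i%:Z) x) -
    \sum_(i < k - (p + p)) F card_weight (shiftn (u + p%:Z + i%:Z) x).
  pose f i := F card_weight (shiftn (u + i%:Z) x).
  have kE : k = (p + (k - (p + p) + p))%N by lia.
  rewrite -[in RHS](big_mkord xpredT f)
    -(big_mkord xpredT (fun i => (outer i)%:R * f i)).
  rewrite -[X in _ = _ - X](big_mkord xpredT
    (fun i => F card_weight (shiftn (u + p%:Z + i%:Z) x))).
  apply/eqP; rewrite eq_sym subr_eq; apply/eqP.
  have p1 : (0 <= p)%N by [].
  have p2 : (p <= k - p)%N by lia.
  have p3 : (k - p <= k)%N by lia.
  rewrite !(big_cat_nat p1 (leq_trans p2 p3)) /= !(big_cat_nat p2 p3) /=.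
  have e1 : \sum_(0 <= i < p) (outer i)%:R * f i = \sum_(0 <= i < p) f i.
    apply: eq_big_nat => i ip; rewrite /outer (_ : (p <= i)%N = false) ?mul1r//.
    lia.
  have e2 : \sum_(p <= i < k - p) (outer i)%:R * f i = 0.
    rewrite big_nat big1// => i ip; rewrite /outer ip mul0r//.
  have e3 : \sum_(k - p <= i < k) (outer i)%:R * f i = \sum_(k - p <= i < k) f
    i.
    apply: eq_big_nat => i ip;
      rewrite /outer (_ : (i < k - p)%N = false) ?andbF ?mul1r//.
    lia.
  have e4 : \sum_(p <= i < k - p) f i =
      \sum_(0 <= i < k - (p + p)) F card_weight (shiftn (u + p%:Z + i%:Z) x).
    rewrite -{1}[p]add0n big_addn (_ : (k - p - p = k - (p + p))%N);
      last by lia.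
    apply: eq_bigr => i _; rewrite /f;
      congr (fine (bridge_sum _ _ _ (shiftn _ x))).
    lia.
  rewrite e1 e2 e3 e4 add0r; ring.
rewrite -outer_sum -sumrB !mulr_sumr -!big_split /=
  (le_trans (ler_norm_sum _ _ _))//.
apply: ler_sum => i _; set t := u + i%:Z.
rewrite !bridge_sum_shift_seq//; last by move=> y z; exact: g0.
rewrite (fsbig_finite _ _ (fin t)).
rewrite -sumrB !mulr_sumr -!big_split /= (le_trans (ler_norm_sum _ _ _))//.
rewrite big_seq_cond [leRHS]big_seq_cond; apply: ler_sum => y; rewrite andbT.
rewrite in_fset_set ?inE => [yB|]; last exact: fin.
have yB' : bridge_vert h coord xs (shiftn t x) (0, y).
  by apply/bridge_vert_shift; rewrite /= add0r.
have -> : root_value y (shiftn t x) = g (net_class (bar x) (t, y)).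
  by rewrite /root_value net_class_bar_bridge_shift// add0r.
have j0 : 0 <= j.+1%:R^-1 :> R by rewrite invr_ge0.
have s0 : 0 <= \1_(sensitive p j y) (shiftn t x) :> R by [].
rewrite !mulr1.
have [oi|] := boolP (outer i).
  by rewrite !mulr1 (le_trans (g_diff _ _))// lerDr addr_ge0// mulr_ge0.
rewrite negbK => /andP[pi ik]; rewrite mulr0 addr0.
(* Seen from time t = u + i, the window extends i steps back and k - i - 1 steps forward; both are
   at least p away from the boundary. *)
have cutE : g (net_class (bar_window I x) (t, y)) = cut_value i (k - i.+1) y
  (shiftn t x).
  rewrite /cut_value (@net_class_bar_bridge_window_shift _ _ _ _ _ _ _ _ t x _
    I)//= ?add0r//.
  - by move=> s; rewrite /I /t /interval_set /=; have := ltn_ord i; lia.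
  - by split => //; rewrite /interval_set /=; have := ltn_ord i; lia.
have rootE : g (net_class (bar x) (t, y)) = root_value y (shiftn t x).
  by rewrite /root_value net_class_bar_bridge_shift// add0r.
rewrite cutE rootE indicE.
have [sens|nsens] := pselect (sensitive p j y (shiftn t x)).
  by rewrite mem_set// mulr1 (le_trans (g_diff _ _))// lerDr.
rewrite memNset// mulr0 addr0 leNgt; apply/negP => big; apply: nsens.
by exists (nat_of_ord i, (k - i.+1)%N); split => //=; lia.
Qed.

Hypothesis M_separable : separable M.
Hypothesis h_measurable : measurable_fun setT
  (h : discreteType S * borelType Xi -> discreteType S).
Hypothesis iota_measurable : measurable_fun setT
  (iota : discreteType S * borelType Xi -> borelType M).
Hypothesis mg : measurable_fun setT g.

Lemma measurable_root_value y : measurable_fun setT (root_value y).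
Proof.
apply: (measurableT_comp mg); apply: measurable_net_class_bar_bridge => // t.
exact: measurable_coord.
Qed.

Lemma measurable_cut_value l r y : measurable_fun setT (cut_value l r y).
Proof.
apply: (measurableT_comp mg); apply: measurable_net_class_bar_bridge_window =>
  // t.
exact: measurable_coord.
Qed.

Lemma measurable_sensitive p j y : measurable (sensitive p j y).
Proof.
apply: (salg_ex (measurable_salg _)) => // -[l r].
apply: (salgI (measurable_salg _)); first exact: (salg_cst (measurable_salg _)).
rewrite (_ : [set _ | _] = (fun x => `|cut_value l r y x - root_value y x|)
  @^-1`
    `]j.+1%:R^-1, +oo[%classic); last first.
  by apply/seteqP; split => x /=; rewrite in_itv/= andbT.
rewrite -[X in measurable X]setTI.
suff m : measurable_fun setT (fun x => `|cut_value l r y x - root_value y x|).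
  exact: m.
  apply: (measurableT_comp (@normr_measurable R setT)); apply: measurable_funB.
    exact: measurable_cut_value.
  exact: measurable_root_value.
Qed.

Context (Q : probability (path Xi) R).
Hypothesis Q_shift : forall k (A : set (path Xi)),
  measurable A -> Q (shiftn k @^-1` A) = Q A.
Hypothesis Q_ergodic : forall A : set (path Xi),
  measurable A -> shiftn 1 @^-1` A = A -> Q A = 0%E \/ Q A = 1%E.
Hypothesis expected_card_lty :
  (\int[Q]_x bridge_sum h xs card_weight x < +oo)%E.
Hypothesis gl : asymptotically_local g.

Local Notation mean a := (fine (\int[Q]_x bridge_sum h xs a x)%E).

Let sensitive_le1 p j y x : 0 <= (\1_(sensitive p j y) x : R) <= 1.
Proof. by rewrite indicE; case: (_ \in _); rewrite ?lexx ?ler01. Qed.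

Let m_sensitive p j y : measurable_fun setT
  (\1_(sensitive p j y) : path Xi -> R).
Proof. by apply: measurable_indic; exact: measurable_sensitive. Qed.

Let card_le1 (y : S) (x : path Xi) : 0 <= (1 : R) <= 1.
Proof. by rewrite ler01 lexx. Qed.

(** Dominated convergence: the sensitive states are almost surely absent for large p, and their
    number is at most #B_0, which is integrable. *)
Lemma mean_sensitive_cvg0 j : mean (sensitive_weight p j) @[p --> \oo] -->
  (0 : R).
Proof.
have [|||||_ _] := @dominated_convergence _ _ _ Q _ measurableT
  (fun p => EFin \o (fine \o bridge_sum h xs (sensitive_weight p j))) (cst 0%E)
    (EFin \o (fine \o bridge_sum h xs card_weight)).
- move=> p; have /integrableP[] // :=
    integrable_bridge_sum S_countable h_measurable
    expected_card_lty (m_sensitive p j) (sensitive_le1 p j).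
- exact: measurable_cst.
- apply: filterS (ae_bridge_states_finite S_countable h_measurable Q_shift
    expected_card_lty).
  move=> x fin _; apply: cvg_near_cst;
    apply: filterS (sensitive_vanish j gl fin).
  by move=> p /= ->.
- exact: (integrable_bridge_sum S_countable h_measurable expected_card_lty
    (fun=> measurable_cst _) card_le1).
- apply: filterS (ae_bridge_states_finite S_countable h_measurable Q_shift
    expected_card_lty).
  move=> x fin p _ /=; rewrite lee_fin !bridge_sum_finite//; try exact: fin.
  rewrite ger0_norm; last by apply: fsumr_ge0 => y _;
    case/andP: (sensitive_le1 p j y x).
  rewrite !fsbig_finite//; try exact: fin.
  by apply: ler_sum => y _; case/andP: (sensitive_le1 p j y x).
rewrite integral0 => lim.
have E p : (\int[Q]_x (EFin \o (fine \o bridge_sum h xs (sensitive_weight p j)))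
  x)%E = (mean (sensitive_weight p j))%:E.
  exact: (integral_fine_bridge_sumE S_countable h_measurable Q_shift
    expected_card_lty (m_sensitive p j) (sensitive_le1 p j)).
apply: (@fine_cvg _ _ _ _ (fun p => (mean (sensitive_weight p j))%:E)).
by apply: cvg_trans lim; apply: near_eq_cvg; apply: nearW => p; rewrite /= -E.
Qed.

(** The spine puts [xs] in B_0 on every path, so the mean is at least 1. *)
Lemma mean_card_gt0 : 0 < mean card_weight.
Proof.
apply: fine_gt0; rewrite expected_card_lty andbT.
apply: (@lt_le_trans _ _ (\int[Q]_x (cst 1%E) x)%E).
  by rewrite integral_cst//= probability_setT mule1 lte01.
apply: le_integral_nonmeasurable => x //.
apply: esum_ge; exists [set xs]; last by rewrite fsbig_set1.
by split => // _ ->; exact: spine_bridge_vert.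
Qed.

Lemma path_window_average (u : nat -> int) (k : nat -> nat) :
  (forall K, \forall n \near \oo, (K <= k n)%N) ->
  (forall p : nat, exists t0, \forall n \near \oo,
     u n + p%:Z <= t0 <= u n + (k n)%:Z - p%:Z) ->
  {ae Q, forall x,
    (\sum_(v \in bridge_window h coord xs (interval_set (u n) (k n)) x)
       g (net_class (bar_window (interval_set (u n) (k n)) x) v)) /
    (\sum_(v \in bridge_window h coord xs (interval_set (u n) (k n)) x) (1 : R))
      @[n --> \oo] --> mean root_value / mean card_weight}.
Proof.
move=> k_oo ut.
have avg (a : S -> path Xi -> R) (L : R) :
    (forall y, measurable_fun setT (a y)) -> (forall y x, 0 <= a y x <= L) ->
    {ae Q, forall x, forall (u : nat -> int) (k : nat -> nat) (t0 : int),
    (\forall n \near \oo, u n <= t0 <= u n + (k n)%:Z) ->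
    (forall K, \forall n \near \oo, (K <= k n)%N) ->
    (\sum_(i < k n) F a (shiftn (u n + i%:Z) x)) / (k n)%:R @[n --> \oo] -->
      mean a}.
  move=> ma aL; apply: (ergodic_window_average Q_shift Q_ergodic
    (F := fine \o bridge_sum h xs a)).
    exact: (integrable_bridge_sum S_countable h_measurable expected_card_lty ma
      aL).
  exact: (integral_fine_bridge_sumE S_countable h_measurable Q_shift
    expected_card_lty ma aL).
have avg_card := avg _ _ (fun=> measurable_cst _) card_le1.
have avg_root := avg _ _ measurable_root_value (fun y x => gK _).
have avg_sensitive : {ae Q, forall x, forall p j : nat,
    forall (u : nat -> int) (k : nat -> nat) (t0 : int),
    (\forall n \near \oo, u n <= t0 <= u n + (k n)%:Z) ->
    (forall K, \forall n \near \oo, (K <= k n)%N) ->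
    (\sum_(i < k n) F (sensitive_weight p j) (shiftn (u n + i%:Z) x)) /
      (k n)%:R @[n --> \oo] --> mean (sensitive_weight p j)}.
  apply/ae_foralln => p; apply/ae_foralln => j.
  exact: avg _ _ (m_sensitive p j) (sensitive_le1 p j).
have ae_fin := ae_bridge_states_finite S_countable h_measurable Q_shift
  expected_card_lty.
apply: filterS (filterI ae_fin
  (filterI avg_card (filterI avg_root avg_sensitive))).
move=> x [fin [{}avg_card [{}avg_root {}avg_sensitive]]] {avg}.
have [t0 ut0] := ut 0%N.
have {}ut0 : \forall n \near \oo, u n <= t0 <= u n + (k n)%:Z.
  by apply: filterS ut0 => n; rewrite addr0 subr0.
have k0 : \forall n \near \oo, (k n)%:R != 0 :> R.
  by apply: filterS (k_oo 1%N) => n; rewrite pnatr_eq0 -lt0n.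
have cardE n : \sum_(v \in bridge_window h coord xs (interval_set (u n) (k n))
  x) (1 : R)
    = \sum_(i < k n) F card_weight (shiftn (u n + i%:Z) x).
  rewrite (bridge_window_sum _ fin (fun=> 1)); apply: eq_bigr => i _.
  by rewrite bridge_sum_shift.
have card_lim : (\sum_(v \in bridge_window h coord xs (interval_set (u n) (k n))
  x) (1 : R))
    / (k n)%:R @[n --> \oo] --> mean card_weight.
  under eq_fun do rewrite cardE.
  exact: avg_card ut0 k_oo.
(* Numerator and denominator are both normalised by the number [k n] of times, so that each becomes
   an ergodic average. *)
apply: cvg_ratio k0 _ card_lim; first by rewrite gt_eqF// mean_card_gt0.
apply: (cvg_approximation (K := K)
  (s := fun n => (\sum_(i < k n) F root_value (shiftn (u n + i%:Z) x)) /
    (k n)%:R)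
  (v := fun n => (\sum_(i < k n) F card_weight (shiftn (u n + i%:Z) x)) /
    (k n)%:R)
  (w := fun p n => (\sum_(i < k n - (p + p))
     F card_weight (shiftn (u n + p%:Z + i%:Z) x)) / (k n)%:R)
  (d := fun j p n => (\sum_(i < k n)
     F (sensitive_weight p j) (shiftn (u n + i%:Z) x)) / (k n)%:R)
  (z := fun j p => mean (sensitive_weight p j)) (y := mean card_weight)) => //.
- move=> j p; apply: filterS (k_oo (p + p)%N) => n pk.
  rewrite -mulrBl normrM [X in _ * X]ger0_norm ?invr_ge0//.
  have ki0 : 0 <= (k n)%:R^-1 :> R by rewrite invr_ge0.
  apply: le_trans (ler_wpM2r ki0 (window_error (u n) j fin pk)) _.
  rewrite le_eqVlt; apply/orP; left; apply/eqP; ring.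
- exact: avg_root ut0 k_oo.
- exact: avg_card ut0 k_oo.
(* The trimmed window must itself contain a fixed base point, hence one at distance p from both ends
   of the original window. *)
- move=> p; have [t1 ut1] := ut p;
    apply: (cvg_trimmed_average (p := (p + p)%N)) => //.
  apply: avg_card (t1) _ _.
    apply: filterS2 ut1 (k_oo (p + p)%N) => n; lia.
  move=> L; apply: filterS (k_oo (L + (p + p))%N) => n; lia.
- by move=> j p; exact: avg_sensitive ut0 k_oo.
- exact: mean_sensitive_cvg0.
Qed.

End windows.

(** * Integration against the measure P^square *)

Section eq_set_function_integral.
Import HBNNSimple.

(* The integral only involves the measures of measurable sets, so that no
   measure structure is needed on [m1] and [m2]. *)
Lemma eq_set_function_integral d (T : measurableType d) (R : realType)
    (m1 m2 : set T -> \bar R) (f : T -> \bar R) :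
  (forall A, measurable A -> m1 A = m2 A) ->
  (\int[m1]_x f x = \int[m2]_x f x)%E.
Proof.
move=> m12; rewrite /integral.
have E (u : T -> \bar R) :
    [set sintegral m1 v | v in
      [set v : {nnsfun T >-> R} | forall x, (v x)%:E <= u x]]%E =
    [set sintegral m2 v | v in
      [set v : {nnsfun T >-> R} | forall x, (v x)%:E <= u x]]%E.
  by apply: eq_imagel => v _; apply: eq_fsbigr => r _; rewrite m12.
by rewrite !E.
Qed.

End eq_set_function_integral.

Lemma ge0_integral_mrestr d (T : measurableType d) (R : realType)
    (mu : {measure set T -> \bar R}) (D : set T) (mD : measurable D)
    (f : T -> \bar R) : measurable_fun setT f -> (forall x, 0 <= f x)%E ->
  (\int[mrestr mu mD]_x f x = \int[mu]_(x in D) f x)%E.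
Proof.
move=> mf f0; rewrite -(setUv D) ge0_integral_setU//=.
- rewrite [X in (_ + X)%E](_ : _ = 0%E).
    rewrite adde0; apply: (eq_measure_integral mu) => A mA AD.
    by rewrite /= /mrestr setIidl.
  rewrite (eq_measure_integral mzero) ?integral_measure_zero// => A mA AD.
  rewrite /= /mrestr (_ : A `&` D = set0) ?measure0//.
  by apply/seteqP; split => // x [/AD].
- exact: measurableC.
- by rewrite setUv.
- by apply/disj_setPCl.
Qed.

Section campbell.
Context d (X : measurableType d) (R : realType) (Q : {measure set X -> \bar R}).
Context d' (Y : measurableType d').
Context (I : choiceType) (I_countable : countable [set: I]).
Context (E : I -> set X) (k : I -> {nonneg R}) (psi : I -> X -> Y).
Hypothesis mE : forall i, measurable (E i).
Hypothesis mpsi : forall i, measurable_fun setT (psi i).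

(** Covers two cases: all roots at time 0 with weight 1, for P^square, and pairs (vertex set, root)
    with uniform weights, for the random root. *)
Definition weighted_sum (f : Y -> R) (x : X) : \bar R :=
  (\esum_(i in [set: I]) ((k i)%:num * \1_(E i) x * f (psi i x))%:E)%E.

Let term f i x := ((k i)%:num * \1_(E i) x * f (psi i x))%:E : \bar R.

Let measurable_term (f : Y -> R) i : measurable_fun setT f ->
  measurable_fun setT (term f i).
Proof.
move=> mf; apply/measurable_EFinP; apply: measurable_funM.
  by apply: measurable_funM => //; exact: measurable_indic.
exact: (measurableT_comp mf).
Qed.

Let term_ge0 (f : Y -> R) i x : (forall y, 0 <= f y) -> (0 <= term f i x)%E.
Proof. by move=> f0; rewrite lee_fin !mulr_ge0. Qed.

Lemma measurable_weighted_sum (f : Y -> R) : measurable_fun setT f ->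
  (forall y, 0 <= f y) -> measurable_fun setT (weighted_sum f).
Proof.
move=> mf f0; apply: measurable_countable_esum => // i;
  first exact: measurable_term.
by move=> x; exact: term_ge0.
Qed.

Let m i : {measure set Y -> \bar R} := mscale (k i)
  (measure_function_pushforward__canonical__measure_function_Measure
     (mrestr Q (mE i)) (mpsi i)).

Let integral_m (f : Y -> R) i : measurable_fun setT f -> (forall y, 0 <= f y) ->
  (\int[m i]_y (f y)%:E = \int[Q]_x term f i x)%E.
Proof.
move=> mf f0; have mEf : measurable_fun setT (EFin \o f)
  by exact/measurable_EFinP.
have mfpsi : measurable_fun setT (fun x => (f (psi i x))%:E).
  exact: (measurableT_comp mEf).
rewrite ge0_integral_mscale//; last by move=> y _; rewrite lee_fin.
rewrite ge0_integral_pushforward//=; last by move=> y _; rewrite lee_fin.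
rewrite ge0_integral_mrestr//=; last by move=> x; rewrite lee_fin.
rewrite integral_mkcond -ge0_integralZl_EFin//.
- apply: eq_integral => x _; rewrite /term patchE indicE /=.
  by case: ifPn => _; rewrite ?mulr1 ?mulr0 ?mul0r ?mule0// EFinM.
- by move=> x _; rewrite patchE; case: ifP; rewrite // lee_fin.
- by apply/(measurable_restrictT _ (mE i)); exact: measurable_funTS.
Qed.

(** The right-hand side on indicators is a series of scaled pushforwards of restrictions of [Q], a
    measure by construction. Integrating against that series extends the formula to functions, while
    [mu] is only asked to agree with it on measurable sets. *)
Lemma campbell (mu : set Y -> \bar R) (c : {nonneg R}) :
  (forall A, measurable A ->
     mu A = c%:num%:E * \int[Q]_x weighted_sum \1_A x)%E ->
  exists m : {measure set Y -> \bar R},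
    (forall A, measurable A -> mu A = m A) /\
    forall f : Y -> R, measurable_fun setT f -> (forall y, 0 <= f y) ->
    (\int[m]_y (f y)%:E = c%:num%:E * \int[Q]_x weighted_sum f x)%E.
Proof.
move=> muE.
have [dec decE] := countable_esum R I_countable.
pose m_ n : {measure set Y -> \bar R} := if dec n is Some i then m i else mzero.
have int_m_ (u : Y -> R) : measurable_fun setT u -> (forall y, 0 <= u y) ->
    (\int[mscale c (mseries m_ 0)]_y (u y)%:E =
     c%:num%:E * \int[Q]_x weighted_sum u x)%E.
  move=> mu0 u0; have mEu : measurable_fun setT (EFin \o u)
    by exact/measurable_EFinP.
  rewrite ge0_integral_mscale//; last by move=> y _; rewrite lee_fin.
  congr (_ * _)%E; rewrite ge0_integral_measure_series//; last first.
    by move=> y _; rewrite lee_fin.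
  rewrite integral_countable_esum//; last 2 first.
  - by move=> i; exact: measurable_term.
  - by move=> i x; exact: term_ge0.
  rewrite decE; last by move=> i; apply: integral_ge0 => x _; exact: term_ge0.
  apply: eq_eseriesr => n _; rewrite /m_; case: (dec n) => [i|] /=.
    exact: integral_m.
  exact: integral_measure_zero.
exists (mscale c (mseries m_ 0)); split; last exact: int_m_.
by move=> A mA; rewrite muE// -int_m_ ?integral_indic ?setIT.
Qed.

End campbell.

(** * Finite intervals of integers *)

Section integer_intervals.

Lemma finite_int_bounded (A : set int) : finite_set A ->
  exists B : nat, forall t, A t -> `|t| <= B%:Z.
Proof.
move=> /finite_fsetP[X XA]; exists (\max_(t <- X) absz t)%N => t;
  rewrite XA /= => tX.
by rewrite -abszE lez_nat; exact: leq_bigmax_seq.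
Qed.

Lemma convex_finite_interval (A : set int) : finite_set A ->
  (forall a b t, A a -> A b -> a <= t <= b -> A t) ->
  exists u k, A = interval_set u k.
Proof.
move=> /finite_int_bounded[B HB] conv.
have [[a Aa]|nA] := pselect (exists a, A a); last first.
  exists 0, 0%N; apply/seteqP; split => t; first by move=> At; case: nA;
    exists t.
  by rewrite /interval_set /=; lia.
(* Adding the bound [B] moves all members into the naturals, where a least and a largest one can be
   extracted. *)
have exmin : exists m : nat, `[< A (m%:Z - B%:Z) >].
  exists (absz (a + B%:Z)); apply/asboolP.
  by rewrite (_ : _ - _ = a)//; have := HB _ Aa; lia.
have exmax : exists m : nat, `[< A (m%:Z - B%:Z) >] by exact: exmin.
have bound m : `[< A (m%:Z - B%:Z) >] -> (m <= B + B)%N.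
  by move=> /asboolP /HB; lia.
case: (ex_minnP exmin) => m /asboolP Am minm.
case: (ex_maxnP exmax bound) => n /asboolP An maxn.
have mn : (m <= n)%N by apply: minm; exact/asboolP.
exists (m%:Z - B%:Z), (n - m).+1; apply/seteqP; split => t.
  move=> At; have tB := HB _ At.
  have At' : `[< A ((absz (t + B%:Z))%:Z - B%:Z) >].
    by apply/asboolP; rewrite (_ : _ - _ = t)//; lia.
  have := minm _ At'; have := maxn _ At'; rewrite /interval_set /=; lia.
by rewrite /interval_set /= => tk; apply: conv Am An _; lia.
Qed.

Lemma finite_interval (A : set int) : finite_set A ->
  (exists i : interval int, A = [set` i]) -> exists u k, A = interval_set u k.
Proof.
move=> fA [i Ai]; apply: convex_finite_interval => // a b t.
by rewrite Ai /= => ia ib tab; apply: (@interval_is_interval _ i a b).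
Qed.

Lemma interval_set_sub u k u' k' : (0 < k)%N ->
  interval_set u k `<=` interval_set u' k' ->
  u' <= u /\ u + k%:Z <= u' + k'%:Z.
Proof.
move=> k0 sub; have := sub u; have := sub (u + k%:Z - 1).
rewrite /interval_set /= => h1 h2; lia.
Qed.

Lemma interval_set_proper u k u' k' :
  interval_set u k `<` interval_set u' k' -> (k < k')%N.
Proof.
move=> [sub nsub]; rewrite ltnNge; apply/negP => kk; apply: nsub => t.
have [k0|k0] := posnP k; first by rewrite /interval_set /=; lia.
have [] := interval_set_sub k0 sub; rewrite /interval_set /=; lia.
Qed.

Variables (I : nat -> set int) (u : nat -> int) (k : nat -> nat).
Hypothesis Iuk : forall n, I n = interval_set (u n) (k n).
Hypothesis I_increasing : forall n, I n `<` I n.+1.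

Lemma interval_length_ge n : (n <= k n)%N.
Proof.
elim: n => // n IH; apply: leq_ltn_trans IH _.
by apply: (@interval_set_proper (u n) _ (u n.+1)); rewrite -!Iuk.
Qed.

Lemma interval_length_oo K : \forall n \near \oo, (K <= k n)%N.
Proof. by exists K => // n /= Kn; exact: leq_trans (interval_length_ge n). Qed.

Lemma interval_sub m n : (m <= n)%N -> I m `<=` I n.
Proof.
move=> /subnKC <-; elim: (n - m)%N => [|j IH]; first by rewrite addn0.
by rewrite addnS; apply: subset_trans IH _; case: (I_increasing (m + j)).
Qed.

(** Strict growth makes the window of index 2p + 1 at least that long, so its point at distance p
    from the left end is also p away from the right end; larger windows only increase these
    distances. *)
Lemma interval_center (p : nat) : exists t0, \forall n \near \oo,
  u n + p%:Z <= t0 <= u n + (k n)%:Z - p%:Z.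
Proof.
pose m := (p + p).+1; exists (u m + p%:Z); exists m => // n /= mn.
have km := interval_length_ge m;
  have k0 : (0 < k m)%N by rewrite (leq_trans _ km).
have sub : interval_set (u m) (k m) `<=` interval_set (u n) (k n).
  by rewrite -!Iuk; exact: interval_sub.
have [] := interval_set_sub k0 sub; rewrite /m in km *; lia.
Qed.

End integer_intervals.

(** * Test functions on the space of networks *)

Section bounded_functions.
Context (R : realType) (M : completeMetricType R).
Implicit Types (g : Gstar M -> R).

Lemma local_asymptotically_local g : local_functional g ->
  asymptotically_local g.
Proof.
move=> [N gN] C e e0; exists N => D CD.
by rewrite (gN _ _ CD) subrr normr0 ltW.
Qed.

Lemma gdist_balls_similar_eq (C D : Gstar M) n :
  balls_similar eq n.+1 C D -> gdist C D <= (n.+2%:R)^-1.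
Proof.
move=> [N [N' [CN DN' [f [bf fo fadj fv fe]]]]]; apply: gdist_balls_similar.
exists N, N'; split => //; exists f; split => //.
  by move=> w /fv ->; rewrite mdistxx invr_gt0.
by move=> w w' /fe ->; rewrite mdistxx invr_gt0.
Qed.

Lemma continuous_asymptotically_local g : continuous g ->
  asymptotically_local g.
Proof.
move=> cg C e e0.
have oA : open (g @^-1` [set y | `|g C - y| < e]).
  by apply: open_comp => [? _|]; [exact: cg | exact: (ball_open (g C) e)].
have [d d0 dA] : exists2 d, 0 < d & forall D, gdist C D < d -> `|g C - g D| < e.
  by apply: (oA C); rewrite /= subrr normr0.
(* Equal balls of radius N put the classes within 1/(N + 1), which is below d for this N. *)
exists (Num.bound d^-1).+1 => D /gdist_balls_similar_eq CD.
apply/ltW/dA; apply: le_lt_trans CD _.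
rewrite invf_plt ?posrE// (lt_trans (archi_boundP _))// ?invr_ge0 ?ltW//.
by rewrite ltr_nat.
Qed.

Lemma continuous_measurable_Gstar g : continuous g -> measurable_fun setT g.
Proof.
move=> cg; apply: (measurability _ (RGenOInfty.measurableE R)) => //.
move=> _ [_ [a ->] <-]; rewrite setTI; apply: sub_sigma_algebra.
by apply: open_comp => [? _|]; [exact: cg | exact: interval_open].
Qed.

End bounded_functions.

(** Reduces a bounded signed function to the nonnegative f + K, the case covered by [campbell]. *)
Lemma integral_shift_constant d (Y : measurableType d) (R : realType)
    (m : {measure set Y -> \bar R}) (f : Y -> R) (K : R) :
  m setT = 1%E -> measurable_fun setT f -> (forall y, `|f y| <= K) ->
  (\int[m]_y (f y)%:E = \int[m]_y (f y + K)%:E - K%:E)%E.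
Proof.
move=> m1 mf fK.
have mfin : (m setT < +oo)%E by rewrite m1 ltry.
have intK : m.-integrable setT (EFin \o cst K).
  apply: measurable_bounded_integrable => //.
  by exists `|K|; split => // c Kc y _ /=; exact: ltW.
have intf : m.-integrable setT (EFin \o f).
  apply: le_integrable intK => //; first exact/measurable_EFinP.
  move=> y _; rewrite /= lee_fin [leRHS]ger0_norm//.
  exact: le_trans (fK y).
have -> : (\int[m]_y (f y + K)%:E = \int[m]_y
  ((EFin \o f) y + (EFin \o cst K) y))%E.
  by [].
rewrite integralD//= integral_cst// m1 mule1 -addeA subee// adde0//.
Qed.

(** * P^square as a probability measure *)

Section square_measure.
Context d (Omega : measurableType d) (R : realType) (P : probability Omega R).
Context (S : pointedType) (S_countable : countable [set: S]).
Context (Xi : completeMetricType R) (h : S * Xi -> S).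
Hypothesis h_measurable : measurable_fun setT
  (h : discreteType S * borelType Xi -> discreteType S).
Context (xi : int -> Omega -> Xi).
Hypothesis xi_measurable : forall t,
  measurable_fun setT (xi t : Omega -> borelType Xi).
Hypothesis xi_stationary : stationary P xi.
Context (xs : S) (xs_recurrent : positive_recurrent P h xi xs).
Context (M : completeMetricType R) (M_separable : separable M).
Context (iota : S * Xi -> M).
Hypothesis iota_measurable : measurable_fun setT
  (iota : discreteType S * borelType Xi -> borelType M).
Context (kappa : bool -> M).

Local Notation Q := (path_law P xi_measurable).
Local Notation mean a := (fine (\int[Q]_x bridge_sum h xs a x)%E).
Local Notation card_weight := (fun (_ : S) (_ : path Xi) => 1%R : R).
Local Notation root_value := (root_value h xs iota kappa).
Local Notation bar := (bar_bridge h xi xs iota kappa).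
Local Notation Psq := (square_measure P h xi xs iota kappa).

Lemma path_law_card_lty : (\int[Q]_x bridge_sum h xs card_weight x < +oo)%E.
Proof.
apply: expected_bridge_card_lty => //.
  by move=> j A mA; exact: path_law_shift.
rewrite ge0_integral_path_law.
- apply: le_lt_trans xs_recurrent; apply: le_integral_nonmeasurable => w.
    by apply: nneseries_ge0 => n _ _; rewrite lee_fin.
  exact: sum_no_return_le_return_time.
- apply: ge0_emeasurable_sum => [n x _ _|n _]; first by rewrite lee_fin.
  by apply/measurable_EFinP; apply: measurable_indic;
    exact: measurable_no_return.
- by move=> x; apply: nneseries_ge0 => n _ _; rewrite lee_fin.
Qed.

Let counting_esum (B : set S) : counting B = (\esum_(y in B) 1 :> \bar R)%E.
Proof.
rewrite /counting; case: asboolP => [fB|infB]; last first.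
  apply/esym/eqP; rewrite -leye_eq leNgt; apply/negP => /esum_lty_finite_set.
  exact: infB.
rewrite (esum_finite_EFin (a := fun=> 1))//.
rewrite (fsbig_finite _ (fun=> 1) fB) big_const_seq count_predT iter_addr_0//.
Qed.

Let E (y : S) := [set w | bridge_vert h xi xs w (0, y)].
Let psi (y : S) w := net_class (bar w) (0, y).

Let one (_ : S) : {nonneg R} := 1%:nng.

Let bridge_sum_root_value (g : Gstar M -> R) w :
  weighted_sum E one psi g w =
  bridge_sum h xs (root_value g) (trajectory xi w).
Proof.
rewrite /bridge_sum esum_mkcond; apply: eq_esum => y _; rewrite mul1r indicE.
rewrite (_ : (w \in E y) = (y \in bridge_states h (@coord Xi) xs
  (trajectory xi w) 0)).
  by case: ifPn => _; rewrite ?mul1r ?mul0r// /psi bar_bridge_path.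
by apply/idP/idP; rewrite !inE.
Qed.

Let esum_window (F : int * S -> \bar R) w :
  \esum_(v in bridge_window h xi xs [set 0] w) F v =
  \esum_(y in bridge_states h xi xs w 0) F (0, y).
Proof.
rewrite (_ : bridge_window h xi xs [set 0] w = pair 0 @` bridge_states h xi xs w
  0).
  by rewrite esum_image// => y z _ _ [].
apply/seteqP; split => [[t y] [yB /= t0]|[t y] [z zB [<- <-]]]; last by [].
by exists y; rewrite -t0.
Qed.

Lemma square_measure_integral : exists m : {measure set (Gstar M) -> \bar R},
  [/\ m setT = 1%E, forall A, measurable A -> Psq A = m A &
  forall (g : Gstar M -> R) K, measurable_fun setT g ->
    (forall C, 0 <= g C <= K) ->
    (\int[m]_C (g C)%:E = (mean (root_value g) / mean card_weight)%:E)%E].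
Proof.
have card_fin := path_law_card_lty.
have nu0 := mean_card_gt0 card_fin.
have card0 x : (0 <= bridge_sum h xs card_weight x)%E by exact: bridge_sum_ge0.
have mcard : measurable_fun setT (bridge_sum h xs card_weight).
  exact: measurable_bridge_sum.
have meanE : (\int[P]_w counting (bridge_states h xi xs w 0) =
    (mean card_weight)%:E)%E.
  rewrite fineK; last by rewrite ge0_fin_numE//; exact: integral_ge0.
  rewrite ge0_integral_path_law//; apply: eq_integral => w _.
  exact: counting_esum.
have mE y : measurable (E y) by exact: measurable_bridge_vert.
have mpsi y : measurable_fun setT (psi y).
  exact: measurable_net_class_bar_bridge.
have c0 : 0 <= (mean card_weight)^-1 by rewrite invr_ge0 ltW.
have PsqE A : measurable A -> Psq A = ((NngNum c0)%:num%:E *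
    \int[P]_w weighted_sum E one psi \1_A w)%E.
  move=> mA; rewrite /square_measure meanE inver gt_eqF//; congr (_ * _)%E.
  apply: eq_integral => w _; rewrite esum_window bridge_sum_root_value.
  by apply: eq_esum => y _; rewrite /root_value -bar_bridge_path.
have [m [mPsq intm]] := campbell S_countable mE mpsi PsqE.
have int_mean (g : Gstar M -> R) K : measurable_fun setT g ->
    (forall C, 0 <= g C <= K) ->
    (\int[m]_C (g C)%:E = (mean (root_value g) / mean card_weight)%:E)%E.
  move=> mg gK; have g0 C : 0 <= g C by case/andP: (gK C).
  have mroot y : measurable_fun setT (root_value g y).
    exact: measurable_root_value.
  have root0 y x : 0 <= root_value g y x <= K by exact: gK.
  have root_ge0 y x : 0 <= root_value g y x by exact: g0.
  rewrite intm// mulrC EFinM; congr (_ * _)%E.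
  rewrite fineK; last first.
    rewrite ge0_fin_numE; last first.
      by apply: integral_ge0 => x _; exact: bridge_sum_ge0.
    exact: (integral_bridge_sum_lty S_countable h_measurable card_fin root0).
  rewrite ge0_integral_path_law.
  - by apply: eq_integral => w _; exact: bridge_sum_root_value.
  - exact: measurable_bridge_sum.
  - by move=> x; exact: bridge_sum_ge0.
(* The total mass is the formula just proved for the constant 1, where the two means coincide. *)
exists m; split => //.
have one01 (C : Gstar M) : 0 <= (cst 1 C : R) <= 1 by rewrite /= ler01 lexx.
have := int_mean _ _ (measurable_cst _) one01.
rewrite -[X in X = _]/(\int[m]_C (cst 1%E C))%E integral_cst//= mul1e => ->.
by rewrite [X in (X / _)%:E](_ : _ = mean card_weight)// divff// gt_eqF.
Qed.

End square_measure.

(** * Uniform roots *)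

Lemma countable_fsets (V : choiceType) : countable [set: V] ->
  countable [set: {fset V}].
Proof.
move=> cV; have /pcard_injP[pk] := cV; rewrite /= => pkI.
have pk_inj : injective pk by move=> u v; apply: pkI; rewrite inE.
apply/countable_injP; exists (fun A : {fset V} => choice.pickle
  (map pk (enum_fset A) : seq nat)).
move=> A B _ _ /(pcan_inj choice.pickleK)/(inj_map pk_inj) AB.
by apply/fsetP => v; rewrite -[v \in A]/(v \in enum_fset A) AB.
Qed.

Section uniform_root.
Context d (Omega : measurableType d) (R : realType) (P : probability Omega R).
Context (M : completeMetricType R) (M_separable : separable M).
Context (V : choiceType) (V_countable : countable [set: V]).
Context (W : Omega -> set V) (o : Omega -> V) (G : Omega -> mgraph M V).
Hypothesis mW : forall v, measurable [set w | W w v].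
Hypothesis mo : forall v, measurable [set w | o w = v].
Hypothesis mG : graph_events G `<=` measurable.
Hypothesis W_finite : {ae P, forall w, finite_set (W w)}.
Hypothesis o_uniform : conditionally_uniform P W o.
Hypothesis o_independent : conditionally_independent P W o G.

Let sO := measurable_salg Omega.

(** An index (A, v) pairs a possible finite value of the vertex set with a possible root. There are
    countably many of them, so conditioning becomes a countable partition. *)
Let is_window (i : {fset V} * V) := [set w | W w = [set` i.1]].

Let weight (i : {fset V} * V) : {nonneg R} :=
  if i.2 \in i.1 then (#|` i.1|%:R^-1)%:nng else 0%:nng.

Let root_class (i : {fset V} * V) w : Gstar M := net_class (G w) i.2.

Let measurable_is_window i : measurable (is_window i).
Proof.
rewrite (_ : is_window i = [set w | forall v, W w v <-> v \in i.1]).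
  apply: (salg_all sO) => // v; apply: (salg_iff sO) => //.
  exact: (salg_cst sO).
apply/seteqP; split => w /=; first by move=> -> v.
by move=> h; apply/seteqP; split => v /h.
Qed.

Let measurable_root_class i : measurable_fun setT (root_class i).
Proof.
by move=> _ C mC; rewrite setTI; apply: mG; exact: graph_events_net_class.
Qed.

Definition root_average (f : Gstar M -> R) (w : Omega) : \bar R :=
  weighted_sum is_window weight root_class f w.

Lemma measurable_root_average (f : Gstar M -> R) : measurable_fun setT f ->
  (forall C, 0 <= f C) -> measurable_fun setT (root_average f).
Proof.
move=> mf f0; apply: measurable_weighted_sum => //.
exact: (countable_prodT (countable_fsets V_countable)).
Qed.

(** Only the indices whose first component is the realised vertex set contribute, and their weights
    make up the uniform average over it. *)
Lemma root_averageE (f : Gstar M -> R) w : (forall C, 0 <= f C) ->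
  finite_set (W w) -> root_average f w =
  ((\sum_(v \in W w) f (net_class (G w) v)) / (#|` fset_set (W w)|)%:R)%:E.
Proof.
move=> f0 fW; set A := fset_set (W w);
  have WA : W w = [set` A] by rewrite fset_setK.
rewrite /root_average /weighted_sum.
rewrite (_ : (fun i => _) = (fun i => if i \in pair A @` [set` A] then
    ((weight i)%:num * \1_(is_window i) w * f (root_class i w))%:E else 0%E)).
  rewrite -(esum_mkcond (pair A @` [set` A]) (fun i => ((weight i)%:num *
    \1_(is_window i) w * f (root_class i w))%:E)).
  rewrite esum_image; last by move=> u v _ _ [].
  rewrite esum_finite_EFin => [||v _]; last 2 first.
  - exact: finite_fset.
  - by rewrite !mulr_ge0.
  rewrite WA [X in _ = (X / _)%:E](fsbig_finite _ _ (finite_fset A)).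
  rewrite (fsbig_finite _ _ (finite_fset A)) set_fsetK mulr_suml; congr EFin.
  rewrite big_seq [RHS]big_seq; apply: eq_bigr => v vA.
  rewrite /weight /= vA indicE mem_set/= ?mulr1 1?mulrC//.
apply/funext => -[B v]; case: ifPn => //; rewrite notin_setE => nBv.
rewrite indicE; have [wB|wB] := pselect (is_window (B, v) w); last first.
  by rewrite memNset// mulr0 mul0r.
have BA : B = A.
  apply/fsetP => x; have : W w x <-> x \in B by rewrite [W w]wB.
  by rewrite WA /= => xAB; apply/idP/idP => /xAB.
rewrite /weight /=; case: ifPn => vB; last by rewrite !mul0r.
by case: nBv; exists v; rewrite -BA.
Qed.

(** Conditional independence comes as an identity multiplied by P(W = A). This factor is cancelled
    when it is nonzero; otherwise both sides vanish. *)
Let probability_root (i : {fset V} * V) D : graph_events G D ->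
  P ([set w | o w = i.2] `&` D `&` is_window i) =
  ((weight i)%:num%:E * P (D `&` is_window i))%E.
Proof.
move=> GD; have mD := mG GD.
have := o_independent i.1 i.2 GD; rewrite o_uniform.
rewrite -[[set w | W w = _]]/(is_window i).
rewrite (_ : (if i.2 \in i.1 then _ else _) = (weight i)%:num%:E); last first.
  by rewrite /weight; case: ifP.
have m1 : measurable ([set w | o w = i.2] `&` D `&` is_window i).
  by apply: measurableI => //; exact: measurableI.
have m2 : measurable (D `&` is_window i) by exact: measurableI.
have [P0 _|P0] := eqVneq (P (is_window i)) 0%E.
  have z X : measurable X -> X `<=` is_window i -> P X = 0%E.
    move=> mX sX; apply/eqP; rewrite eq_le measure_ge0 andbT -P0.
    by rewrite le_measure// inE.
  by rewrite !z ?mule0// => w [].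
have fin X : measurable X -> exists a, P X = a%:E.
  by move=> mX; exists (fine (P X)); rewrite fineK// fin_num_measure.
have [a ->] := fin _ m1; have [e ->] := fin _ m2.
have [b Pb] := fin _ (measurable_is_window i); rewrite Pb in P0 *.
rewrite -!EFinM => -[ab]; congr EFin.
have b0 : b != 0 by apply: contra P0 => /eqP ->.
by apply: (mulIf b0); rewrite ab; ring.
Qed.

(** The event is partitioned by the values of the vertex set and of the root. On each piece the root
    is a constant, so the class becomes a [graph_events] variable and [probability_root] replaces
    the root by its weight. *)
Lemma probability_uniform_root (C : set (Gstar M)) : measurable C ->
  P [set w | C (net_class (G w) (o w))] = (\int[P]_w root_average \1_C w)%E.
Proof.
move=> mC; have cI := countable_prodT (countable_fsets V_countable) V_countable.
pose F i := [set w | o w = i.2] `&` [set w | C (root_class i w)] `&` is_window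
  i.
have mclass i : measurable [set w | C (root_class i w)].
  by have := measurable_root_class i measurableT mC; rewrite setTI.
have mF i : measurable (F i).
  by apply: measurableI => //; exact: measurableI.
have mEF i : measurable_fun setT (fun w => (\1_(F i) w : R)%:E).
  by apply/measurable_EFinP; exact: measurable_indic.
have mphi : measurable [set w | C (net_class (G w) (o w))].
  rewrite (_ : [set _ | _] = [set w | exists v,
    o w = v /\ C (net_class (G w) v)]).
    apply: (salg_ex sO) => // v; apply: (salgI sO) => //.
    by apply: mG; exact: graph_events_net_class.
  by apply/seteqP; split => w /=; [exists (o w)|case=> v [->]].
rewrite integral_countable_esum//; last first.
  move=> i; apply/measurable_EFinP; apply: measurable_funM.
    by apply: measurable_funM => //; exact: measurable_indic.
  by apply: (measurableT_comp _ (measurable_root_class i));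
    exact: measurable_indic.
rewrite -(setIT [set w | _]) -integral_indic//.
transitivity (\int[P]_w (\esum_(i in [set: {fset V} * V]) (\1_(F i) w)%:E))%E.
  apply: ge0_ae_eq_integral => //.
  - by apply/measurable_EFinP; exact: measurable_indic.
  - by apply: measurable_countable_esum => // i w; rewrite lee_fin.
  - by move=> w _; exact: esum_ge0.
  (* When the vertex set is finite, [i0] is the only index that [w] can belong to. *)
  apply: filterS W_finite => w fW _; pose i0 := (fset_set (W w), o w).
  rewrite (_ : (fun i => _) = (fun i => if i \in [set i0] then (\1_(F i) w)%:E
    else 0%E)).
    rewrite -esum_mkcond esum_set1 ?lee_fin//; congr ((nat_of_bool _)%:R%:E).
    rewrite /F /i0 /is_window /=; apply/idP/idP; rewrite !inE /=.
      by move=> ?; do !split => //; rewrite fset_setK.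
    by move=> [[]].
  apply/funext => -[A v]; case: ifPn => //; rewrite notin_setE => ni.
  rewrite indicE memNset// => -[[/= ov _] wA]; apply: ni.
  by rewrite /i0 /= ov wA set_fsetK.
rewrite integral_countable_esum//.
apply: eq_esum => i _; rewrite integral_indic// setIT.
have GC : graph_events G [set w | C (root_class i w)]
  by exact: graph_events_net_class.
rewrite [LHS](probability_root i GC).
have mI : measurable ([set w | C (root_class i w)] `&` is_window i).
  exact: measurableI.
rewrite -[P _](_ : \int[P]_w (\1_([set w | C (root_class i w)] `&` is_window i)
  w)%:E = _)%E; last first.
  by rewrite integral_indic// setIT.
rewrite -ge0_integralZl_EFin//.
- apply: eq_integral => w _; rewrite -EFinM; congr EFin.
  rewrite indicI /= -mulrA; congr (_ * _); rewrite mulrC; congr (_ * _).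
- by apply/measurable_EFinP; exact: measurable_indic.
Qed.

Lemma measurable_uniform_root :
  measurable_fun setT (fun w => net_class (G w) (o w) : Gstar M).
Proof.
move=> _ C mC; rewrite setTI.
rewrite (_ : _ @^-1` _ = [set w | exists v, o w = v /\ C (net_class (G w) v)]).
  apply: (salg_ex sO) => // v; apply: (salgI sO) => //.
  by apply: mG; exact: graph_events_net_class.
by apply/seteqP; split => w /=; [exists (o w)|case=> v [->]].
Qed.

Lemma integral_uniform_root (f : Gstar M -> R) : measurable_fun setT f ->
  (forall C, 0 <= f C) ->
  (\int[pushforward P (fun w => net_class (G w) (o w))]_C (f C)%:E =
   \int[P]_w root_average f w)%E.
Proof.
move=> mf f0.
have cI := countable_prodT (countable_fsets V_countable) V_countable.
have [A mA|m [mE intm]] := campbell (c := 1%:nng) cI measurable_is_window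
    measurable_root_class (k := weight) (Q := P)
    (mu := pushforward P (fun w => net_class (G w) (o w))).
  by rewrite mul1e -probability_uniform_root.
by rewrite (eq_set_function_integral _ mE) intm// mul1e.
Qed.

End uniform_root.

(** * Convergence of the averages over the windows *)

Section bridge_averages.
Context d (Omega : measurableType d) (R : realType) (P : probability Omega R).
Context (S : pointedType) (S_countable : countable [set: S]).
Context (Xi : completeMetricType R) (h : S * Xi -> S).
Hypothesis h_measurable : measurable_fun setT
  (h : discreteType S * borelType Xi -> discreteType S).
Context (xi : int -> Omega -> Xi).
Hypothesis xi_measurable : forall t,
  measurable_fun setT (xi t : Omega -> borelType Xi).
Hypothesis xi_stationary : stationary P xi.
Hypothesis xi_ergodic : ergodic P xi.
Context (xs : S) (xs_recurrent : positive_recurrent P h xi xs).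
Context (M : completeMetricType R) (M_separable : separable M).
Context (iota : S * Xi -> M).
Hypothesis iota_measurable : measurable_fun setT
  (iota : discreteType S * borelType Xi -> borelType M).
Context (kappa : bool -> M).
Context (I : nat -> set int) (u : nat -> int) (k : nat -> nat).
Hypothesis Iuk : forall n, I n = interval_set (u n) (k n).
Hypothesis I_increasing : forall n, I n `<` I n.+1.

Local Notation Q := (path_law P xi_measurable).
Local Notation mean a := (fine (\int[Q]_x bridge_sum h xs a x)%E).
Local Notation card_weight := (fun (_ : S) (_ : path Xi) => 1%R : R).
Local Notation root_value := (root_value h xs iota kappa).
Local Notation VI n := (bridge_window h xi xs (I n)).
Local Notation BI n := (bar_bridge_window h xi xs iota kappa (I n)).

Let card_fin : (\int[Q]_x bridge_sum h xs card_weight x < +oo)%E.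
Proof. exact: path_law_card_lty. Qed.

Lemma ae_bridge_window_finite : {ae P, forall w, forall n, finite_set (VI n w)}.
Proof.
have fin := ae_path_law (ae_bridge_states_finite S_countable h_measurable
  (path_law_shift xi_measurable xi_stationary) card_fin).
apply: filterS fin => w fin n; rewrite Iuk.
exact: (bridge_window_finite (u n) fin (k n)).
Qed.

Lemma ae_root_average_cvg (g : Gstar M -> R) (K : R) :
  measurable_fun setT g -> (forall C, 0 <= g C <= K) ->
    asymptotically_local g ->
  {ae P, forall w,
    (\sum_(v \in VI n w) g (net_class (BI n w) v)) / (#|` fset_set (VI n w)|)%:R
    @[n --> \oo] --> mean (root_value g) / mean card_weight}.
Proof.
move=> mg gK gl.
have Qs := path_law_shift xi_measurable xi_stationary.
have Qe := path_law_ergodic xi_measurable xi_ergodic.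
have lim := ae_path_law (path_window_average S_countable kappa gK M_separable
  h_measurable iota_measurable mg Qs Qe card_fin gl
  (interval_length_oo Iuk I_increasing) (interval_center Iuk I_increasing)).
apply: filterS2 ae_bridge_window_finite lim => w fin.
rewrite (_ : (fun n => _) = (fun n =>
  (\sum_(v \in VI n w) g (net_class (BI n w) v)) /
    (#|` fset_set (VI n w)|)%:R))//.
apply/funext => n; congr (_ / _); rewrite -?Iuk.
  by apply: eq_fsbigr => v _; rewrite -bar_bridge_window_path.
rewrite (fsbig_finite _ (fun=> 1) (fin n)).
by rewrite big_const_seq count_predT iter_addr_0.
Qed.

End bridge_averages.

Theorem proposition4p15 (R : realType) (d : measure_display)
    (Omega : measurableType d) (P : probability Omega R)
    (S : pointedType) (S_countable : countable [set: S])
    (Xi : completeMetricType R) (Xi_separable : separable Xi)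
    (h : S * Xi -> S)
    (h_measurable : measurable_fun setT
       (h : discreteType S * borelType Xi -> discreteType S))
    (xi : int -> Omega -> Xi)
    (xi_measurable : forall t,
       measurable_fun setT (xi t : Omega -> borelType Xi))
    (xi_stationary : stationary P xi) (xi_ergodic : ergodic P xi)
    (xs : S) (xs_recurrent : positive_recurrent P h xi xs)
    (* the common mark space and the embeddings into it *)
    (M : completeMetricType R) (M_separable : separable M)
    (M_uncountable : ~ countable [set: M])
    (iota : S * Xi -> M)
    (iota_measurable : measurable_fun setT
       (iota : discreteType S * borelType Xi -> borelType M))
    (iota_injective : injective iota)
    (kappa : bool -> M) (kappa_injective : injective kappa)
    (I : nat -> set int)
    (I_interval : forall n, exists i : interval int, I n = [set` i])
    (I_finite : forall n, finite_set (I n))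
    (I_increasing : forall n, I n `<` I n.+1) :
  let VI n := bridge_window h xi xs (I n) in
  let BI n := bar_bridge_window h xi xs iota kappa (I n) in
  let Psq : set (Gstar M) -> \bar R := square_measure P h xi xs iota kappa in
  (forall g : Gstar M -> R,
     measurable_fun setT g -> (forall C, 0 <= g C) ->
     (exists K, forall C, g C <= K) -> local_functional g ->
     {ae P, forall w,
       ((\sum_(v \in VI n w) g (net_class (BI n w) v)) /
          (#|` fset_set (VI n w)|)%:R)%:E @[n --> \oo]
       --> (\int[Psq]_C (g C)%:E)%E}) /\
  (forall o : nat -> Omega -> int * S,
     (forall n v, measurable [set w | o n w = v]) ->
     (forall n, conditionally_uniform P (VI n) (o n)) ->
     (forall n, conditionally_independent P (VI n) (o n) (BI n)) ->
     weak_cvg (fun n => pushforward P (fun w => net_class (BI n w) (o n w)))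
       Psq).
Proof.
move=> VI BI Psq.
have /choice[u /choice[k Iuk]] : forall n, exists u, exists k,
  I n = interval_set u k.
  by move=> n; apply: finite_interval.
have VI_finite := ae_bridge_window_finite S_countable h_measurable xi_measurable
  xi_stationary xs_recurrent Iuk.
have avg := ae_root_average_cvg S_countable h_measurable xi_measurable
  xi_stationary
  xi_ergodic xs_recurrent M_separable iota_measurable kappa Iuk I_increasing.
have [m [m1 mPsq int_m]] := square_measure_integral S_countable h_measurable
  xi_measurable xi_stationary xs_recurrent M_separable iota_measurable kappa.
split.
  move=> g mg g0 [K gK] gl.
  have g0K C : 0 <= g C <= K by rewrite g0 gK.
  rewrite (eq_set_function_integral _ mPsq) (int_m _ _ mg g0K).
  apply: filterS (avg _ _ mg g0K (local_asymptotically_local gl)) => w lim.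
  by apply: cvg_EFin => //; exact: nearW.
move=> o mo o_uniform o_indep f cf [K fK].
have mf := continuous_measurable_Gstar cf.
have K0 : 0 <= K by exact: le_trans (fK point).
(* Adding the bound makes the test function nonnegative with values in [0, 2K]; the constant is
   removed again from both integrals. *)
pose g C := f C + K.
have g0K C : 0 <= g C <= K + K.
  by have := fK C; rewrite ler_norml /g => /andP[? ?]; apply/andP; split; lra.
have g0 C : 0 <= g C by case/andP: (g0K C).
have mg : measurable_fun setT g by exact: measurable_funD.
have gl : asymptotically_local g.
  move=> C e e0; have [N fN] := continuous_asymptotically_local cf C e0.
  by exists N => D /fN; rewrite /g opprD addrACA subrr addr0.
have cV := countable_prodT (countableP [set: int]) S_countable.
have mVI n v : measurable [set w | VI n w v].
  apply: (salgI (measurable_salg _)); first exact: measurable_bridge_vert.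
  exact: (salg_cst (measurable_salg _)).
have mBI n : graph_events (BI n) `<=` measurable.
  exact: graph_events_bar_bridge_window.
have fVI n : {ae P, forall w, finite_set (VI n w)}.
  by apply: filterS VI_finite => w; apply.
pose phi n w : Gstar M := net_class (BI n w) (o n w).
have mphi n : measurable_fun setT (phi n) by exact: measurable_uniform_root.
pose mu n : {measure set (Gstar M) -> \bar R} :=
  measure_function_pushforward__canonical__measure_function_Measure P (mphi n).
have mu1 n : mu n setT = 1%E by rewrite /mu /= /pushforward preimage_setT
  probability_setT.
rewrite (eq_set_function_integral _ mPsq) (integral_shift_constant m1 mf fK).
rewrite (_ : (fun n => _) = (fun n => \int[mu n]_C (g C)%:E - K%:E)%E);
  last first.
  by apply/funext => n; rewrite -(integral_shift_constant (mu1 n) mf fK).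
pose c : R := fine (\int[path_law P xi_measurable]_x
    bridge_sum h xs (root_value h xs iota kappa g) x)%E /
  fine (\int[path_law P xi_measurable]_x bridge_sum h xs (fun _ _ => 1%R) x)%E.
have int_g : (\int[m]_C (f C + K)%:E)%E = c%:E := int_m _ _ mg g0K.
rewrite int_g; apply: cvgeB => //; last exact: cvg_cst.
have avgE n w : finite_set (VI n w) -> root_average (VI n) (BI n) g w =
    ((\sum_(v \in VI n w) g (net_class (BI n w) v)) /
      (#|` fset_set (VI n w)|)%:R)%:E.
  exact: root_averageE.
have int_mu n : (\int[mu n]_C (g C)%:E = \int[P]_w root_average (VI n) (BI n) g
  w)%E.
  exact: integral_uniform_root.
under eq_fun do rewrite int_mu.
(* The law of the uniform root integrates [g] to the expectation of the window average, which
   converges almost surely and is bounded by K + K. *)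
have [||||| _ _] := @dominated_convergence _ _ _ P _ measurableT
  (fun n => root_average (VI n) (BI n) g) (cst c%:E) (cst (K + K)%:E).
- by move=> n; exact: measurable_root_average.
- exact: measurable_cst.
- apply: filterS2 VI_finite (avg _ _ mg g0K gl) => w fin lim _.
  apply: cvg_EFin; first by apply: nearW => n; rewrite (avgE _ _ (fin n)).
  by apply: cvg_trans lim; apply: near_eq_cvg; apply: nearW => n;
    rewrite /= (avgE _ _ (fin n)).
- exact: finite_measure_integrable_cst.
- apply: filterS VI_finite => w fin n _; rewrite (avgE _ _ (fin n))/= lee_fin.
  rewrite (fsbig_finite _ _ (fin n)) ger0_norm; last first.
    by rewrite mulr_ge0 ?invr_ge0// sumr_ge0.
  (* For an empty window the quotient is 0, the inverse of 0 being 0. *)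
  have [c0|c0] := posnP #|` fset_set (VI n w)|.
    by rewrite c0 invr0 mulr0 addr_ge0.
  rewrite ler_pdivrMr ?ltr0n//
    (@le_trans _ _ (\sum_(v <- fset_set (VI n w)) (K + K)))//.
    by apply: ler_sum => v _; case/andP: (g0K (net_class (BI n w) v)).
  by rewrite big_const_seq count_predT iter_addr_0 mulr_natr.
by rewrite integral_cst//= probability_setT mule1.
Qed.
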